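(* Let $\beta=(\pi_\ell)_{\ell=1}^L$ be any chainable architecture of depth $L\ge 1$, let $\mathbf{A}\in\mathbb{C}^{m\times n}$ with $m=a_1b_1d_1$, $n=a_Lc_Ld_L$, and let $\sigma$ be any permutation of $\{1,\dots,L-1\}$. Let $(\mathbf{X}_\ell)_{\ell=1}^L\in\Sigma^\beta$ be the output of the butterfly algorithm with inputs $(\mathbf{A},\beta,\sigma)$. Then $$\|\mathbf{A}-\mathbf{X}_1\cdots\mathbf{X}_L\|_F\le (\max(L,2)-1)\,E^\beta(\mathbf{A}).$$ If moreover $\sigma$ is the identity permutation $(1,\dots,L-1)$, then $$\|\mathbf{A}-\mathbf{X}_1\cdots\mathbf{X}_L\|_F\le \sqrt{\max(L,2)-1}\,E^\beta(\mathbf{A}).$$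
   Context: A pattern is a tuple $\pi=(a,b,c,d)$ of positive integers; $\mathbf{S}_\pi:=\mathbf{I}_a\otimes\mathbf{1}_{b\times c}\otimes\mathbf{I}_d\in\{0,1\}^{abd\times acd}$ ($\mathbf{I}_k$ identity, $\mathbf{1}_{p\times q}$ all-ones, $\otimes$ Kronecker product). A $\pi$-factor is a complex matrix of size $abd\times acd$ whose support is contained in that of $\mathbf{S}_\pi$; $\Sigma^\pi$ is the set of $\pi$-factors. Patterns $\pi_1=(a_1,b_1,c_1,d_1)$, $\pi_2=(a_2,b_2,c_2,d_2)$ are chainable if $a_1c_1/a_2=b_2d_2/d_1$, this common value $r(\pi_1,\pi_2)$ is an integer, $a_1\mid a_2$ and $d_2\mid d_1$; then $\pi_1*\pi_2:=(a_1,\,b_1d_1/d_2,\,a_2c_2/a_1,\,d_2)$. A chainable pair is redundant if $r(\pi_1,\pi_2)\ge\min(b_1,c_2)$. An architecture $\beta=(\pi_\ell)_{\ell=1}^L$, $\pi_\ell=(a_\ell,b_\ell,c_\ell,d_\ell)$, is a sequence of patterns with $a_\ell c_\ell d_\ell=a_{\ell+1}b_{\ell+1}d_{\ell+1}$; it is chainable if every consecutive pair is chainable (depth $1$ is chainable by convention), and a chainable architecture is redundant if some consecutive pair is redundant (depth $1$ is non-redundant). For chainable $\beta$ and $p\le q$, $\pi_{[p,q]}:=\pi_p*\cdots*\pi_q$ (iterated product; all intermediate pairs are chainable). $\Sigma^\beta:=\Sigma^{\pi_1}\times\cdots\times\Sigma^{\pi_L}$ and $E^\beta(\mathbf{A}):=\inf_{(\mathbf{X}_\ell)\in\Sigma^\beta}\|\mathbf{A}-\mathbf{X}_1\cdots\mathbf{X}_L\|_F$.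 Equivalence classes: for binary $\mathbf{L}\in\{0,1\}^{m\times r},\mathbf{R}\in\{0,1\}^{r\times n}$ let $\mathbf{U}_i:=\mathbf{L}[:,i]\mathbf{R}[i,:]$; define $i\sim j$ iff $\mathbf{U}_i=\mathbf{U}_j$, let $\mathcal{P}(\mathbf{L},\mathbf{R})$ be the resulting partition of $\{1,\dots,r\}$, and for a class $P$ let $R_P\times C_P$ be the support of the common $\mathbf{U}_i$, $i\in P$. TwoFactor$(\mathbf{M},\pi,\pi')$ for chainable $(\pi,\pi')$: start from zero matrices $\mathbf{X},\mathbf{Y}$ of the sizes of $\pi$- and $\pi'$-factors; for each $P\in\mathcal{P}(\mathbf{S}_\pi,\mathbf{S}_{\pi'})$ set $(\mathbf{X}[R_P,P],\mathbf{Y}[P,C_P])$ to any pair $(\mathbf{H},\mathbf{K})\in\mathbb{C}^{|R_P|\times|P|}\times\mathbb{C}^{|P|\times|C_P|}$ minimizing $\|\mathbf{M}[R_P,C_P]-\mathbf{H}\mathbf{K}\|_F$; return $(\mathbf{X},\mathbf{Y})$. Ortho$(\pi,\pi',\mathbf{X},\mathbf{Y},u)$ for a chainable non-redundant pair, $\mathbf{X}\in\Sigma^\pi,\mathbf{Y}\in\Sigma^{\pi'}$: start from zero $\tilde{\mathbf{X}},\tilde{\mathbf{Y}}$; for each $P\in\mathcal{P}(\mathbf{S}_\pi,\mathbf{S}_{\pi'})$: if $u=$ column, take a QR decomposition $\mathbf{X}[R_P,P]=\mathbf{Q}\mathbf{R}$ ($\mathbf{Q}$ with orthonormal columns) and set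 $\tilde{\mathbf{X}}[R_P,P]=\mathbf{Q}$, $\tilde{\mathbf{Y}}[P,C_P]=\mathbf{R}\mathbf{Y}[P,C_P]$; if $u=$ row, take $\mathbf{Y}[P,C_P]^\top=\mathbf{Q}\mathbf{R}$ and set $\tilde{\mathbf{X}}[R_P,P]=\mathbf{X}[R_P,P]\mathbf{R}^\top$, $\tilde{\mathbf{Y}}[P,C_P]=\mathbf{Q}^\top$. Return $(\tilde{\mathbf{X}},\tilde{\mathbf{Y}})$. Butterfly algorithm for non-redundant chainable $\beta$: if $L=1$ return $\mathbf{A}\odot\mathbf{S}_{\pi_1}$ (Hadamard product). Otherwise maintain an ordered list of consecutive intervals $I_1,\dots,I_J$ partitioning $\{1,\dots,L\}$ with factors $\mathbf{X}_{I_k}$; initially $J=1$, $I_1=[1,L]$, $\mathbf{X}_{I_1}=\mathbf{A}$. For $J=1,\dots,L-1$: let $s=\sigma_J$ and $j$ with $s\in I_j=[q,t]$; for $k=1,\dots,j-1$ replace $(\mathbf{X}_{I_k},\mathbf{X}_{I_{k+1}})$ by Ortho$(\pi_{I_k},\pi_{I_{k+1}},\mathbf{X}_{I_k},\mathbf{X}_{I_{k+1}},\text{column})$; for $k=J,J-1,\dots,j+1$ replace $(\mathbf{X}_{I_{k-1}},\mathbf{X}_{I_k})$ by Ortho$(\pi_{I_{k-1}},\pi_{I_k},\mathbf{X}_{I_{k-1}},\mathbf{X}_{I_k},\text{row})$; then compute $(\mathbf{X}_{[q,s]},\mathbf{X}_{[s+1,t]})=$ TwoFactor$(\mathbf{X}_{I_j},\pi_{[q,s]},\pi_{[s+1,t]})$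 and replace $I_j$ by $[q,s],[s+1,t]$ in the list. Output $(\mathbf{X}_{[\ell,\ell]})_{\ell=1}^L$. For a redundant chainable $\beta$: repeatedly replace some redundant consecutive pair $(\pi'_\ell,\pi'_{\ell+1})$ by the single pattern $\pi'_\ell*\pi'_{\ell+1}$ until a non-redundant architecture $\beta'$ is reached, run the algorithm on $(\mathbf{A},\beta',\sigma')$ (with a permutation $\sigma'$ of $\{1,\dots,|\beta'|-1\}$), and output any $(\mathbf{X}_\ell)_{\ell=1}^L\in\Sigma^\beta$ whose product equals the product of the factors obtained for $\beta'$. *)

(* Defs.v *)
From HB Require Import structures.
From mathcomp Require Import all_boot all_order all_algebra.
From mathcomp Require Import complex.
From mathcomp Require Import classical_sets reals.

Set Implicit Arguments.
Unset Strict Implicit.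
Unset Printing Implicit Defensive.

Import Order.TTheory GRing.Theory Num.Theory.

Record pattern := Pattern { pa : nat; pb : nat; pc : nat; pd : nat }.

Definition pattern_pos (p : pattern) : bool :=
  [&& 0 < pa p, 0 < pb p, 0 < pc p & 0 < pd p]%N.

Definition prows (p : pattern) : nat := (pa p * pb p * pd p)%N.
Definition pcols (p : pattern) : nat := (pa p * pc p * pd p)%N.

(** Support of S_pi = I_a (x) 1_{b x c} (x) I_d, 0-based indices:
    row i = i1*(b d) + i2*d + i3, col j = j1*(c d) + j2*d + j3, and
    S_pi[i,j] = [i1 = j1] [i3 = j3]. *)
Definition Sb (p : pattern) (i j : nat) : bool :=
  [&& (i < prows p)%N, (j < pcols p)%N,
      i %/ (pb p * pd p) == j %/ (pc p * pd p) & i %% pd p == j %% pd p].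

Definition chainable (p1 p2 : pattern) : bool :=
  [&& pa p2 %| pa p1 * pc p1, pd p1 %| pb p2 * pd p2,
      (pa p1 * pc p1) %/ pa p2 == (pb p2 * pd p2) %/ pd p1,
      pa p1 %| pa p2 & pd p2 %| pd p1]%N.

Definition rpair (p1 p2 : pattern) : nat := ((pa p1 * pc p1) %/ pa p2)%N.

Definition star (p1 p2 : pattern) : pattern :=
  Pattern (pa p1) ((pb p1 * pd p1) %/ pd p2)%N ((pa p2 * pc p2) %/ pa p1)%N (pd p2).

Definition redundant_pair (p1 p2 : pattern) : bool :=
  chainable p1 p2 && (minn (pb p1) (pc p2) <= rpair p1 p2)%N.

Definition pat0 : pattern := Pattern 1 1 1 1.

Definition consec (r : pattern -> pattern -> Prop) (beta : seq pattern) : Prop :=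
  forall k, (k.+1 < size beta)%N -> r (nth pat0 beta k) (nth pat0 beta k.+1).

Definition architecture (beta : seq pattern) : Prop :=
  [/\ beta <> [::], all pattern_pos beta &
      consec (fun p q => pcols p = prows q) beta].

Definition chainable_arch (beta : seq pattern) : Prop :=
  architecture beta /\ consec (fun p q => chainable p q) beta.

Definition redundant_arch (beta : seq pattern) : Prop :=
  exists k, (k.+1 < size beta)%N /\
            redundant_pair (nth pat0 beta k) (nth pat0 beta k.+1).

(** pi_l, 1-based *)
Definition pi_ (beta : seq pattern) (l : nat) : pattern := nth pat0 beta l.-1.

Definition pint (beta : seq pattern) (p q : nat) : pattern :=
  foldl star (pi_ beta p) [seq pi_ beta l | l <- iota p.+1 (q - p)].

Local Open Scope ring_scope.

Section Butterfly.
Variable R : realType.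
Local Notation C := R[i].

(** A matrix of size m x n is represented by its entries (0-based);
    the sizes are always determined by the patterns involved. *)
Definition mx := nat -> nat -> C.
Definition mx0 : mx := fun _ _ => 0.

Definition mx_of m n (A : 'M[C]_(m, n)) : mx := fun i j =>
  match insub i, insub j with
  | Some i', Some j' => A i' j'
  | _, _ => 0
  end.

Definition mulm (k : nat) (X Y : mx) : mx :=
  fun i j => \sum_(t < k) X i t * Y t j.

Definition sqn (z : C) : R := (@complex.Re R z) ^+ 2 + (@complex.Im R z) ^+ 2.

Definition frob (m n : nat) (M : mx) : R :=
  Num.sqrt (\sum_(i < m) \sum_(j < n) sqn (M i j)).

Definition is_factor (p : pattern) (X : mx) : Prop :=
  forall i j, ~~ Sb p i j -> X i j = 0.

Fixpoint prodl (l : seq (pattern * mx)) : mx :=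
  match l with
  | [::] => fun i j => (i == j)%:R
  | [:: (p, X)] => X
  | (p, X) :: l' => mulm (pcols p) X (prodl l')
  end.

Definition in_Sigma (beta : seq pattern) (Xs : seq mx) : Prop :=
  size Xs = size beta /\
  forall k, (k < size beta)%N -> is_factor (nth pat0 beta k) (nth mx0 Xs k).

Definition arch_rows (beta : seq pattern) := prows (pi_ beta 1).
Definition arch_cols (beta : seq pattern) := pcols (pi_ beta (size beta)).

Definition Ebeta (beta : seq pattern) (A : mx) : R :=
  inf [set e : R | exists Xs, in_Sigma beta Xs /\
         e = frob (arch_rows beta) (arch_cols beta)
               (fun i j => A i j - prodl (zip beta Xs) i j)].

(* Equivalence classes P(L, R) for binary L (m x r), R (r x n)         *)
(* (column indices s, t < r; the class of t is {s < r | simc s t})     *)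

Section Classes.
Variables (m r n : nat) (Lb Rb : nat -> nat -> bool).

Definition Ub (s i j : nat) : bool := Lb i s && Rb s j.

Definition simc (s t : nat) : bool :=
  [forall i : 'I_m, forall j : 'I_n, Ub s i j == Ub t i j].

Definition inR (t i : nat) : bool := (i < m)%N && [exists j : 'I_n, Ub t i j].
Definition inC (t j : nat) : bool := (j < n)%N && [exists i : 'I_m, Ub t i j].

Definition blockres (M H K : mx) (t : nat) : R :=
  Num.sqrt (\sum_(i < m | inR t i) \sum_(j < n | inC t j)
              sqn (M i j - \sum_(s < r | simc s t) H i s * K s j)).

(** TwoFactor relation: (X, Y) is a possible output of TwoFactor(M, ., .) *)
Definition twofactor_rel (M X Y : mx) : Prop :=
  [/\ forall i s, ~~ ((s < r)%N && inR s i) -> X i s = 0,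
      forall s j, ~~ ((s < r)%N && inC s j) -> Y s j = 0 &
      forall t, (t < r)%N -> forall H K : mx,
        blockres M X Y t <= blockres M H K t].

(** Ortho(., ., X, Y, column): QR of X[R_P, P] = Q Rm per class P. *)
Definition ortho_col_rel (X Y X' Y' : mx) : Prop :=
  exists Q Rm : mx,
  [/\ forall t, (t < r)%N ->
        [/\ forall i s, inR t i -> (s < r)%N -> simc s t ->
              X i s = \sum_(u < r | simc u t) Q i u * Rm u s,
            forall s u, (s < r)%N -> (u < r)%N -> simc s t -> simc u t ->
              \sum_(i < m | inR t i) conjc (Q i s) * Q i u = (s == u)%:R &
            forall s u, (s < r)%N -> (u < r)%N -> simc s t -> simc u t ->
              (u < s)%N -> Rm s u = 0],
      forall i s, X' i s = if (s < r)%N && inR s i then Q i s else 0 &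
      forall s j, Y' s j = if (s < r)%N && inC s j
                           then \sum_(u < r | simc u s) Rm s u * Y u j else 0].

(** Ortho(., ., X, Y, row): QR of Y[P, C_P]^T = Q Rm per class P. *)
Definition ortho_row_rel (X Y X' Y' : mx) : Prop :=
  exists Q Rm : mx,
  [/\ forall t, (t < r)%N ->
        [/\ forall s j, (s < r)%N -> simc s t -> inC t j ->
              Y s j = \sum_(u < r | simc u t) Q j u * Rm u s,
            forall s u, (s < r)%N -> (u < r)%N -> simc s t -> simc u t ->
              \sum_(j < n | inC t j) conjc (Q j s) * Q j u = (s == u)%:R &
            forall s u, (s < r)%N -> (u < r)%N -> simc s t -> simc u t ->
              (u < s)%N -> Rm s u = 0],
      forall i s, X' i s = if (s < r)%N && inR s i
                           then \sum_(u < r | simc u s) X i u * Rm s u else 0 &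
      forall s j, Y' s j = if (s < r)%N && inC s j then Q j s else 0].

End Classes.

Definition TwoFactor (M : mx) (p p' : pattern) (X Y : mx) : Prop :=
  twofactor_rel (prows p) (pcols p) (pcols p') (Sb p) (Sb p') M X Y.
Definition OrthoCol (p p' : pattern) (X Y X' Y' : mx) : Prop :=
  ortho_col_rel (prows p) (pcols p) (pcols p') (Sb p) (Sb p') X Y X' Y'.
Definition OrthoRow (p p' : pattern) (X Y X' Y' : mx) : Prop :=
  ortho_row_rel (prows p) (pcols p) (pcols p') (Sb p) (Sb p') X Y X' Y'.

Fixpoint iter_rel {S : Type} (steps : seq nat) (Rel : nat -> S -> S -> Prop)
    (x y : S) : Prop :=
  match steps with
  | [::] => x = y
  | k :: ks => exists z, Rel k x z /\ iter_rel ks Rel z y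
  end.

(** A state is the ordered list of (interval [q,t], factor X_[q,t]). *)
Definition item := ((nat * nat) * mx)%type.
Definition item0 : item := ((0%N, 0%N), mx0).

Section NonRedundant.
Variable beta : seq pattern.

Definition ipat (it : item) : pattern := pint beta it.1.1 it.1.2.

(** k-th column step (1-based k): Ortho on (X_{I_k}, X_{I_{k+1}}) *)
Definition col_step (k : nat) (st st' : seq item) : Prop :=
  let I1 := nth item0 st k.-1 in let I2 := nth item0 st k in
  exists X' Y', OrthoCol (ipat I1) (ipat I2) I1.2 I2.2 X' Y' /\
    st' = set_nth item0 (set_nth item0 st k.-1 (I1.1, X')) k (I2.1, Y').

(** k-th row step (1-based k): Ortho on (X_{I_{k-1}}, X_{I_k}) *)
Definition row_step (k : nat) (st st' : seq item) : Prop :=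
  let I1 := nth item0 st k.-2 in let I2 := nth item0 st k.-1 in
  exists X' Y', OrthoRow (ipat I1) (ipat I2) I1.2 I2.2 X' Y' /\
    st' = set_nth item0 (set_nth item0 st k.-2 (I1.1, X')) k.-1 (I2.1, Y').

Definition split_step (s j : nat) (st st' : seq item) : Prop :=
  let Ij := nth item0 st j.-1 in
  let q := Ij.1.1 in let t := Ij.1.2 in
  exists X1 X2, TwoFactor Ij.2 (pint beta q s) (pint beta s.+1 t) X1 X2 /\
    st' = take j.-1 st ++ [:: ((q, s), X1); ((s.+1, t), X2)] ++ drop j st.

Definition bf_step (sigma : seq nat) (J : nat) (st st' : seq item) : Prop :=
  let s := nth 0%N sigma J.-1 in
  exists j, [/\ (1 <= j <= size st)%N,
    ((nth item0 st j.-1).1.1 <= s <= (nth item0 st j.-1).1.2)%N &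
    exists st1 st2,
      [/\ iter_rel (iota 1 j.-1) col_step st st1,
          iter_rel (rev (iota j.+1 (J - j))) row_step st1 st2 &
          split_step s j st2 st']].

Definition butterfly_nr (A : mx) (sigma : seq nat) (Xs : seq mx) : Prop :=
  if size beta == 1%N then
    Xs = [:: fun i j => A i j * (Sb (pi_ beta 1) i j)%:R]
  else exists st,
    iter_rel (iota 1 (size beta).-1) (bf_step sigma) [:: ((1%N, size beta), A)] st
    /\ Xs = map snd st.

End NonRedundant.

(** merging a redundant consecutive pair; we also track the remaining
    split points (boundaries between consecutive patterns, numbered as
    in the original architecture: boundary l lies between pi_l and pi_{l+1}) *)
Definition merge_step (x y : seq pattern * seq nat) : Prop :=
  exists k, [/\ (k.+1 < size x.1)%N,
    redundant_pair (nth pat0 x.1 k) (nth pat0 x.1 k.+1) &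
    y = (take k x.1 ++ [:: star (nth pat0 x.1 k) (nth pat0 x.1 k.+1)] ++ drop k.+2 x.1,
         take k x.2 ++ drop k.+1 x.2)].

Inductive merges : seq pattern * seq nat -> seq pattern * seq nat -> Prop :=
  | merges_refl x : merges x x
  | merges_step x y z : merge_step x y -> merges y z -> merges x z.

(** permutation of {1..|beta'|-1} induced by sigma on the remaining split
    points bs (listed in increasing order) *)
Definition induced_perm (sigma bs : seq nat) : seq nat :=
  [seq (index x bs).+1 | x <- sigma & x \in bs].

Definition butterfly (A : mx) (beta : seq pattern) (sigma : seq nat)
    (Xs : seq mx) : Prop :=
  (~ redundant_arch beta -> butterfly_nr beta A sigma Xs) /\
  (redundant_arch beta ->
     exists beta' bs Ys,
       [/\ merges (beta, iota 1 (size beta).-1) (beta', bs),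
           ~ redundant_arch beta',
           butterfly_nr beta' A (induced_perm sigma bs) Ys,
           in_Sigma beta Xs &
           forall i j, (i < arch_rows beta)%N -> (j < arch_cols beta)%N ->
             prodl (zip beta Xs) i j = prodl (zip beta' Ys) i j]).

End Butterfly.

(* Main.v *)
Require Import Defs.
From HB Require Import structures.
From mathcomp Require Import all_boot all_order all_algebra.
From mathcomp Require Import complex.
From mathcomp Require Import boolp classical_sets reals.
From mathcomp Require Import zify ring lra.
Set Implicit Arguments.
Unset Strict Implicit.
Unset Printing Implicit Defensive.
Import Order.TTheory GRing.Theory Num.Theory.
Local Open Scope ring_scope.

(** Let [B_J] be the product of the current factors after [J] splits.  Since the
    factors left (right) of the split one have orthonormal columns (rows) in each
    block, [B_J] is a best approximation of [B_(J-1)] among the products of two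
    factors at the boundary [s = sigma_J].  By first-order optimality it is
    obtained from [B_(J-1)] by orthogonally projecting the rows, and also the
    columns, of its blocks.  These projections are contractions that keep the
    supports at every other boundary, so the distance from [B_J] to the products
    of two factors at any boundary never exceeds the distance from [A] to a given
    competitor; hence every split costs at most that distance, and the triangle
    inequality gives the factor [L - 1].  When the splits are performed from left
    to right, the successive errors are moreover orthogonal to each other, because
    [B_(J+1)] stays in the column space of [B_J], and Pythagoras gives the factor
    [sqrt (L - 1)].  No singular value decomposition is needed. *)

(** * Frobenius inner product and optimal two-factor products *)

(** One competitor is fixed throughout and the infimum is taken only at the end, so no minimiser of
    the whole problem has to exist. The obstacle is that projections must respect supports. To carry
    a competitor [F G] at one boundary through a split at a later boundary, each row of [G] is
    projected onto rows of the new right factor, using only coefficients allowed between the two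
    boundaries (an earlier split is the transposed case). These restricted coefficients suffice
    because blocks are described by a block number, which gets finer to the right, and a residue,
    which gets finer to the left: two indices that meet in a common row and in a common column agree
    in both. The QR sweeps enter only through an isometry that turns a best approximation of one
    factor into a best approximation of the full product. *)

Section LinearAlgebra.
Variable R : realType.
Local Notation C := R[i].
Implicit Types (X Y Z V M : mx R) (S : nat -> nat -> bool).

Definition trm X : mx R := fun i j => X j i.
Definition adj X : mx R := fun i j => conjc (X j i).
Definition addm X Y : mx R := fun i j => X i j + Y i j.
Definition subm X Y : mx R := fun i j => X i j - Y i j.
Definition scalem (c : C) X : mx R := fun i j => c * X i j.
Definition trr S : nat -> nat -> bool := fun i j => S j i.

Definition supp S X := forall i j, ~~ S i j -> X i j = 0.
Definition n2 m n X : R := \sum_(i < m) \sum_(j < n) sqn (X i j).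
Definition ip m n X Y : C := \sum_(i < m) \sum_(j < n) X i j * conjc (Y i j).

Lemma mxext X Y : (forall i j, X i j = Y i j) -> X = Y.
Proof. by move=> h; apply/funext => i; apply/funext => j. Qed.

Lemma conjM (x y : C) : conjc (x * y) = conjc x * conjc y.
Proof. exact: rmorphM. Qed.
Lemma conj_sum (I : Type) (r : seq I) (P : pred I) (F : I -> C) :
  conjc (\sum_(i <- r | P i) F i) = \sum_(i <- r | P i) conjc (F i).
Proof. exact: rmorph_sum. Qed.

Lemma sqn_ge0 (z : C) : 0 <= sqn z.
Proof. by rewrite addr_ge0 ?sqr_ge0. Qed.
Lemma sqn0 : sqn (0 : C) = 0.
Proof. by rewrite /sqn /= expr0n /= addr0. Qed.
Lemma sqn_eq0 (z : C) : sqn z = 0 -> z = 0.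
Proof.
case: z => a b /eqP; rewrite /sqn /= paddr_eq0 ?sqr_ge0 // !sqrf_eq0.
by case/andP=> /eqP -> /eqP ->.
Qed.
Lemma sqnB (x y : C) :
  sqn (x - y) = sqn x - 2 * complex.Re (x * conjc y) + sqn y.
Proof. case: x y => [a b] [c d]; rewrite /sqn /=; simpc => /=; ring. Qed.
Lemma Re_sum (I : Type) (r : seq I) (P : pred I) (F : I -> C) :
  complex.Re (\sum_(i <- r | P i) F i) = \sum_(i <- r | P i) complex.Re (F i).
Proof. exact: raddf_sum. Qed.

Lemma n2_ge0 m n X : 0 <= n2 m n X.
Proof. by do 2!apply: sumr_ge0 => ? _; apply: sqn_ge0. Qed.
Lemma n2B m n X Y :
  n2 m n (subm X Y) = n2 m n X - 2 * complex.Re (ip m n X Y) + n2 m n Y.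
Proof.
rewrite /n2 /ip Re_sum mulr_sumr -sumrB -big_split; apply: eq_bigr => i _ /=.
rewrite Re_sum mulr_sumr -sumrB -big_split; apply: eq_bigr => j _ /=.
exact: sqnB.
Qed.
Lemma n2_ip m n X : (n2 m n X)%:C%C = ip m n X X.
Proof.
rewrite /n2 /ip rmorph_sum; apply: eq_bigr => i _; rewrite rmorph_sum.
apply: eq_bigr => j _; case: (X i j) => a b; rewrite /sqn /=; simpc.
by congr (_ +i* _)%C; ring.
Qed.
Lemma n2_Re m n X : n2 m n X = complex.Re (ip m n X X).
Proof. by rewrite -n2_ip. Qed.
Lemma n2_eq0 m n X : n2 m n X <= 0 -> forall i j, (i < m)%N -> (j < n)%N -> X i j = 0.
Proof.
move=> h i j im jn; have /eqP : n2 m n X = 0 by apply/eqP; rewrite eq_le h n2_ge0.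
rewrite psumr_eq0; last by move=> *; apply: sumr_ge0 => *; apply: sqn_ge0.
move/allP/(_ (Ordinal im)); rewrite mem_index_enum => /(_ isT) /=.
rewrite psumr_eq0; last by move=> *; apply: sqn_ge0.
by move/allP/(_ (Ordinal jn)); rewrite mem_index_enum => /(_ isT) /eqP/sqn_eq0.
Qed.
Lemma eq_n2 m n X Y : (forall i j, (i < m)%N -> (j < n)%N -> X i j = Y i j) ->
  n2 m n X = n2 m n Y.
Proof. by move=> h; apply: eq_bigr => i _; apply: eq_bigr => j _; rewrite h. Qed.

Lemma ipC m n X Y : ip m n Y X = conjc (ip m n X Y).
Proof.
rewrite /ip conj_sum; apply: eq_bigr => i _; rewrite conj_sum.
by apply: eq_bigr => j _; rewrite conjM conjcK mulrC.
Qed.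
Lemma ipDl m n X Y Z : ip m n (addm X Y) Z = ip m n X Z + ip m n Y Z.
Proof.
rewrite /ip -big_split; apply: eq_bigr => i _; rewrite -big_split.
by apply: eq_bigr => j _; rewrite mulrDl.
Qed.
Lemma ipBl m n X Y Z : ip m n (subm X Y) Z = ip m n X Z - ip m n Y Z.
Proof.
rewrite /ip -sumrB; apply: eq_bigr => i _; rewrite -sumrB.
by apply: eq_bigr => j _; rewrite mulrBl.
Qed.
Lemma ipBr m n X Y Z : ip m n Z (subm X Y) = ip m n Z X - ip m n Z Y.
Proof. by rewrite ipC ipBl rmorphB /= -!ipC. Qed.
Lemma ipZr m n c X Y : ip m n X (scalem c Y) = conjc c * ip m n X Y.
Proof.
rewrite /ip mulr_sumr; apply: eq_bigr => i _; rewrite mulr_sumr.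
by apply: eq_bigr => j _; rewrite conjM mulrCA.
Qed.
Lemma n2Z m n c X : n2 m n (scalem c X) = sqn c * n2 m n X.
Proof.
rewrite /n2 mulr_sumr; apply: eq_bigr => i _; rewrite mulr_sumr.
apply: eq_bigr => j _; rewrite /scalem; case: c (X i j) => [a b] [u v].
by rewrite /sqn /=; ring.
Qed.

Lemma n2_tr m n X : n2 n m (trm X) = n2 m n X.
Proof. exact: exchange_big. Qed.

Lemma mulm_tr k X Y : trm (mulm k X Y) = mulm k (trm Y) (trm X).
Proof. by apply: mxext => i j; apply: eq_bigr => u _; rewrite mulrC. Qed.
Lemma mulmA k l X Y Z : mulm k X (mulm l Y Z) = mulm l (mulm k X Y) Z.
Proof.
apply: mxext => i j; rewrite /mulm.
under eq_bigr do rewrite mulr_sumr.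
rewrite exchange_big; apply: eq_bigr => u _; rewrite mulr_suml.
by apply: eq_bigr => v _; rewrite mulrA.
Qed.
Lemma mulmBr k X Y Z : mulm k X (subm Y Z) = subm (mulm k X Y) (mulm k X Z).
Proof.
apply: mxext => i j; rewrite /mulm /subm -sumrB.
by apply: eq_bigr => u _; rewrite mulrBr.
Qed.
Lemma mulmBl k X Y Z : mulm k (subm Y Z) X = subm (mulm k Y X) (mulm k Z X).
Proof.
apply: mxext => i j; rewrite /mulm /subm -sumrB.
by apply: eq_bigr => u _; rewrite mulrBl.
Qed.

Lemma ip_adj m n k V X Z :
  ip m n (mulm k V X) Z = ip k n X (mulm m (adj V) Z).
Proof.
rewrite /ip /mulm; under eq_bigr do under eq_bigr do rewrite mulr_suml.
under eq_bigr do rewrite exchange_big.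
rewrite exchange_big; apply: eq_bigr => u _; rewrite exchange_big.
apply: eq_bigr => j _; rewrite conj_sum mulr_sumr; apply: eq_bigr => i _.
by rewrite conjM conjcK; ring.
Qed.

(* Minimise along the complex line through [Y], at the parameter
   [ip D Y / (n2 Y + 1)]. *)
Lemma minimal_ip0 m n (D Y : mx R) :
  (forall c, n2 m n D <= n2 m n (subm D (scalem c Y))) -> ip m n D Y = 0.
Proof.
move=> h; set w := ip m n D Y; set N := n2 m n Y.
have N0 : 0 <= N by apply: n2_ge0.
apply: sqn_eq0; apply/eqP; rewrite eq_le sqn_ge0 andbT.
have e0 : 0 < (N + 1)^-1 by rewrite invr_gt0; lra.
set e := (N + 1)^-1 in e0; have eN : e * N = 1 - e.
  by rewrite /e; field; lra.
have := h (e%:C%C * w); rewrite n2B ipZr n2Z -/w -/N.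
have -> : complex.Re (conjc (e%:C%C * w) * w) = e * sqn w.
  by case: (w) => a b; rewrite /sqn /=; ring.
have -> : sqn (e%:C%C * w) = e ^+ 2 * sqn w.
  by case: (w) => a b; rewrite /sqn /=; ring.
have w0 := sqn_ge0 w.
have -> : e ^+ 2 * sqn w * N = e * sqn w * (e * N) by ring.
rewrite eN => h1; have h2 : 0 <= - (e * sqn w * (1 + e)) by lra.
rewrite leNgt; apply/negP => w1; have : 0 < e * sqn w * (1 + e).
  by rewrite !mulr_gt0 //; lra.
lra.
Qed.

Lemma n2_pyth m n X Y : ip m n X Y = 0 -> n2 m n (addm X Y) = n2 m n X + n2 m n Y.
Proof.
move=> h; have -> : addm X Y = subm X (scalem (-1) Y).
  by apply: mxext => i j; rewrite /addm /subm /scalem mulN1r opprK.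
by rewrite n2B ipZr h mulr0 n2Z /sqn /=; ring.
Qed.

(** A triangle inequality without square roots: from [n2 X <= k^2 e] and [n2 Y <= e] it yields
    [n2 (X + Y) <= (k + 1)^2 e]. Entrywise, the two sides differ by [|x - k y|^2]. *)
Lemma n2_add_amgm m n (k : R) X Y : 0 < k ->
  k * n2 m n (addm X Y) <= (k + 1) * n2 m n X + k * (k + 1) * n2 m n Y.
Proof.
move=> k0; rewrite /n2 !mulr_sumr -big_split; apply: ler_sum => i _ /=.
rewrite !mulr_sumr -big_split; apply: ler_sum => j _ /=.
rewrite /addm; case: (X i j) (Y i j) => [a b] [c d]; rewrite /sqn /=.
have := sqr_ge0 (a - k * c); have := sqr_ge0 (b - k * d); lra.
Qed.

(** Optimality over all blocks together, and not class by class as in [TwoFactor]: in this form it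
    can be multiplied by outer factors. *)
Definition opt m r n SL SR M X Y :=
  [/\ supp SL X, supp SR Y & forall H K, supp SL H -> supp SR K ->
    n2 m n (subm M (mulm r X Y)) <= n2 m n (subm M (mulm r H K))].

Lemma supp_tr S X : supp S X -> supp (trr S) (trm X).
Proof. by move=> h i j; apply: h. Qed.

Lemma opt_tr m r n SL SR M X Y : opt m r n SL SR M X Y ->
  opt n r m (trr SR) (trr SL) (trm M) (trm Y) (trm X).
Proof.
case=> sX sY h; split; [exact: supp_tr|exact: supp_tr|] => H K sH sK.
rewrite -mulm_tr -[n2 n m _]/(n2 n m (trm (subm M (mulm r X Y)))) n2_tr.
have := h (trm K) (trm H) (supp_tr sK) (supp_tr sH).
by rewrite -[X in _ <= X]n2_tr -[trm (subm _ _)]/(subm (trm M) (trm (mulm _ _ _))) mulm_tr.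
Qed.

(** With [X] frozen, the admissible right factors form a linear space, so the first-order condition
    at [Y] is orthogonality of the residual. *)
Lemma opt_orthr m r n SL SR M X Y K : opt m r n SL SR M X Y -> supp SR K ->
  ip m n (subm M (mulm r X Y)) (mulm r X K) = 0.
Proof.
case=> sX sY h sK; apply: minimal_ip0 => c.
apply: le_trans (h X (addm Y (scalem c K)) sX _) _.
  by move=> i j Sij; rewrite /addm /scalem sY // sK // mulr0 addr0.
rewrite le_eqVlt; apply/orP; left; apply/eqP; apply: eq_n2 => i j _ _.
rewrite /subm /mulm /scalem /addm mulr_sumr -addrA -opprD -big_split /=.
by congr (_ - _); apply: eq_bigr => u _; ring.
Qed.

Lemma ip_tr m n X Y : ip n m (trm X) (trm Y) = ip m n X Y.
Proof. exact: exchange_big. Qed.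

Lemma opt_orthl m r n SL SR M X Y H : opt m r n SL SR M X Y -> supp SL H ->
  ip m n (subm M (mulm r X Y)) (mulm r H Y) = 0.
Proof.
move=> /opt_tr o sH; rewrite -ip_tr mulm_tr.
rewrite -[trm (subm _ _)]/(subm (trm M) (trm (mulm _ _ _))) mulm_tr.
exact: opt_orthr o (supp_tr sH).
Qed.

End LinearAlgebra.

(** * Projections *)

Section Projection.
Variable R : realType.
Local Notation C := R[i].
Implicit Types (X Y Z V M D F G H : mx R).

Definition lincomb r (c : nat -> C) (F : nat -> mx R) : mx R :=
  fun i j => \sum_(v < r) c v * F v i j.

Lemma ip_lincomb m n r c (F : nat -> mx R) Z :
  ip m n Z (lincomb r c F) = \sum_(v < r) conjc (c v) * ip m n Z (F v).
Proof.
rewrite /ip [RHS](eq_bigr (fun v : 'I_r => \sum_(i < m) \sum_(j < n)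
  conjc (c v) * (Z i j * conjc (F v i j)))); last first.
  by move=> v _; rewrite mulr_sumr; apply: eq_bigr => i _; rewrite mulr_sumr.
rewrite [RHS]exchange_big; apply: eq_bigr => i _.
rewrite [RHS]exchange_big; apply: eq_bigr => j _; rewrite conj_sum mulr_sumr.
by apply: eq_bigr => v _; rewrite conjM mulrCA.
Qed.

(* One step of Gram-Schmidt: [w] is the part of [F r] orthogonal to the
   previous vectors; if [w = 0] the division by zero below is harmless. *)
Lemma orthogonal_projection m n r (P : pred nat) (F : nat -> mx R) Z :
  exists c : nat -> C, (forall v, ~~ (P v && (v < r)%N) -> c v = 0) /\
    forall v, (v < r)%N -> P v -> ip m n (subm Z (lincomb r c F)) (F v) = 0.
Proof.
elim: r Z => [|r IH] Z; first by exists (fun=> 0).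
have [Pr|nPr] := boolP (P r); last first.
  have [c [c0 cF]] := IH Z; exists c; split=> [v|v vr Pv].
    move=> h; apply: c0; apply: contra h => /andP[-> vr] /=; exact: ltnW.
  have -> : lincomb r.+1 c F = lincomb r c F.
    apply: mxext => i j; rewrite /lincomb big_ord_recr /= (c0 r) ?mul0r ?addr0 //.
    by rewrite negb_and nPr.
  move: vr; rewrite ltnS leq_eqVlt => /orP[/eqP vr|]; last by move=> ?; apply: cF.
  by move: nPr; rewrite -vr Pv.
have [c [c0 cF]] := IH Z; have [b [b0 bF]] := IH (F r).
set w := subm (F r) (lincomb r b F); set z := subm Z (lincomb r c F).
pose l := ip m n z w / ip m n w w.
have res : subm Z (lincomb r.+1 (fun v => if v == r then l else c v - l * b v) F)
    = subm z (scalem l w).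
  apply: mxext => i j; rewrite {1}/subm /lincomb big_ord_recr /= eqxx.
  rewrite (eq_bigr (fun v : 'I_r => c v * F v i j - l * (b v * F v i j))); last first.
    by move=> v _; rewrite (negbTE (_ : _ != _)) ?neq_ltn ?ltn_ord //; ring.
  rewrite sumrB -mulr_sumr /z /w /subm /scalem /lincomb; ring.
have low v : (v < r)%N -> P v -> ip m n (subm z (scalem l w)) (F v) = 0.
  move=> vr Pv; rewrite ipBl cF // sub0r; apply/eqP; rewrite oppr_eq0 ipC ipZr.
  by rewrite ipC bF // conjc0 mulr0 conjc0.
have topw : ip m n (subm z (scalem l w)) w = 0.
  rewrite ipBl [ip _ _ (scalem _ _) _]ipC ipZr conjM conjcK -ipC.
  have [w0|w0] := eqVneq (ip m n w w) 0; last by rewrite /l mulfVK // subrr.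
  rewrite w0 mulr0 subr0 /ip big1 // => i _; rewrite big1 // => j _.
  have h : n2 m n w <= 0.
    by rewrite n2_Re w0.
  by rewrite (n2_eq0 h) ?conjc0 ?mulr0.
exists (fun v => if v == r then l else c v - l * b v); split=> [v|v].
  have [->|vr] := eqVneq v r; first by rewrite Pr ltnSn.
  rewrite ltnS leq_eqVlt (negbTE vr) /= => h; rewrite c0 // b0 //; ring.
rewrite res ltnS leq_eqVlt => /orP[/eqP-> _|]; last exact: low.
have -> : F r = addm w (lincomb r b F).
  by apply: mxext => i j; rewrite /w /addm /subm subrK.
rewrite ipC ipDl -[ip m n w _]conjcK -ipC topw.
rewrite -[ip m n (lincomb _ _ _) _]conjcK -ipC ip_lincomb big1 ?conjc0 ?addr0 ?conjc0 //.
move=> v' _; have [Pv'|nPv'] := boolP (P v'); first by rewrite low ?mulr0.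
by rewrite b0 ?negb_and ?nPv' // conjc0 mul0r.
Qed.

Lemma supp_mulm r (SL SR S : nat -> nat -> bool) X Y :
  (forall i u j, SL i u -> SR u j -> S i j) ->
  supp SL X -> supp SR Y -> supp S (mulm r X Y).
Proof.
move=> h sX sY i j nS; rewrite /mulm big1 // => u _.
have [hL|/sX->] := boolP (SL i u); last by rewrite mul0r.
have [hR|/sY->] := boolP (SR u j); last by rewrite mulr0.
by move: nS; rewrite (h _ _ _ hL hR).
Qed.

Lemma supp_subm (S : nat -> nat -> bool) X Y : supp S X -> supp S Y -> supp S (subm X Y).
Proof. by move=> sX sY i j nS; rewrite /subm sX ?sY ?subr0. Qed.

(** Entries are indexed by all pairs of naturals; the common support inside the [m] by [n] range
    turns norm zero into equality of functions. *)
Lemma supp_eq m n (S : nat -> nat -> bool) X Y :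
  (forall i j, S i j -> (i < m)%N && (j < n)%N) ->
  supp S X -> supp S Y -> n2 m n (subm X Y) <= 0 -> X = Y.
Proof.
move=> hS sX sY h; apply: mxext => i j; apply/eqP; rewrite -subr_eq0; apply/eqP.
have [/hS/andP[im jn]|nS] := boolP (S i j); first exact: (n2_eq0 h).
by rewrite sX ?sY ?subr0.
Qed.

(* Four successive levels q, p, s, t; [Sxy] is the support allowed between
   levels x and y. *)
Variables (nq np ns nt : nat) (Sqp Sqs Sps Spt Sst : nat -> nat -> bool).
Hypothesis comp_qps : forall k i u, Sqp k i -> Sps i u -> Sqs k u.
Hypothesis comp_pst : forall i u j, Sps i u -> Sst u j -> Spt i j.
(** Indices [i] and [u] that meet in a row [k] and in a column [j] may be linked by a coefficient.
    Hence restricting coefficients to [Sps] loses nothing in the products below. *)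
Hypothesis key : forall k i u j, Sqp k i -> Sqs k u -> Spt i j -> Sst u j -> Sps i u.

(** Pythagoras: with [h G0] the restricted row projection of [G], [B - F G] is the sum of
    [(B - F0 G0) - F (G - h G0)] and [(F0 - F h) G0]. These are orthogonal, and the second one is
    the new error. *)
Lemma best_factor_projects (B F0 G0 F G : mx R) :
  supp Sqs F0 -> supp Sst G0 -> supp Sqp F -> supp Spt G ->
  (forall H, supp Sqs H ->
    ip nq nt (subm B (mulm ns F0 G0)) (mulm ns H G0) = 0) ->
  exists h : mx R, supp Sps h /\
    n2 nq nt (subm (mulm ns F0 G0) (mulm np F (mulm ns h G0)))
      <= n2 nq nt (subm B (mulm np F G)).
Proof.
move=> sF0 sG0 sF sG orth.
(* Row [u] of [G], seen as a matrix with one row, is projected onto the span of the rows [v] of [G0]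
   with [Sps u v]. *)
have /choice [h hP] := fun u => orthogonal_projection 1 nt ns (Sps u)
  (fun v => fun _ j => G0 v j) (fun _ j => G u j).
have sh : supp Sps h by move=> u v nS; rewrite (hP u).1 // negb_and nS.
exists h; split=> //; pose Ga := subm G (mulm ns h G0).
have sGa : supp Spt Ga by apply: supp_subm => //; apply: supp_mulm sh sG0.
have dot0 u v : (v < ns)%N -> Sps u v -> \sum_(j < nt) Ga u j * conjc (G0 v j) = 0.
  by move=> vs Suv; have := (hP u).2 v vs Suv; rewrite /ip big_ord1.
(* In the expanded product, a pair [(u, v)] in [Sps] vanishes by [dot0]; for any other pair [key]
   forces one of the four entries to be zero. *)
have orthF H : supp Sqs H -> ip nq nt (mulm np F Ga) (mulm ns H G0) = 0.
  move=> sH; rewrite /ip big1 // => i _.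
  rewrite (eq_bigr (fun j : 'I_nt => \sum_(u < np) \sum_(v < ns)
     (F i u * conjc (H i v)) * (Ga u j * conjc (G0 v j)))); last first.
    move=> j _; rewrite /mulm conj_sum mulr_suml; apply: eq_bigr => u _.
    by rewrite mulr_sumr; apply: eq_bigr => v _; rewrite conjM; ring.
  rewrite exchange_big big1 // => u _; rewrite exchange_big big1 // => v _ /=.
  rewrite -mulr_sumr; have [Siu|/sF->] := boolP (Sqp i u); last by rewrite !mul0r.
  have [Siv|/sH->] := boolP (Sqs i v); last by rewrite conjc0 mulr0 mul0r.
  have [Suv|nSuv] := boolP (Sps u v); first by rewrite dot0 ?mulr0.
  rewrite big1 ?mulr0 // => j _.
  have [Suj|/sGa->] := boolP (Spt u j); last by rewrite mul0r.
  have [Svj|/sG0->] := boolP (Sst v j); last by rewrite conjc0 mulr0.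
  by case/negP: nSuv; apply: key Siu Siv Suj Svj.
pose H := subm F0 (mulm np F h).
have sH : supp Sqs H by apply: supp_subm => //; apply: supp_mulm sF sh.
have WE : subm (mulm ns F0 G0) (mulm np F (mulm ns h G0)) = mulm ns H G0.
  by rewrite mulmA mulmBl.
have -> : subm B (mulm np F G) = addm
    (subm (subm B (mulm ns F0 G0)) (mulm np F Ga)) (mulm ns H G0).
  by rewrite -WE mulmBr; apply: mxext => i j; rewrite /addm /subm; ring.
rewrite n2_pyth ?WE; last by rewrite ipBl orth // orthF // subrr.
by rewrite lerDr n2_ge0.
Qed.

Variable V : mx R.
Hypothesis sV : supp Sqp V.
Hypothesis Vortho : forall i i' j, Spt i j -> Spt i' j ->
  \sum_(k < nq) conjc (V k i) * V k i' = (i == i')%:R.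

(** Restricted to positions in [Spt], since columns of [V] that share no column of [Spt] are not
    assumed orthogonal. *)
Lemma adj_mulmK D i j : supp Spt D -> (i < np)%N -> Spt i j ->
  mulm nq (adj V) (mulm np V D) i j = D i j.
Proof.
move=> sD ip Sij; rewrite mulmA /mulm.
rewrite (bigD1 (Ordinal ip)) //= (@Vortho _ _ j) // eqxx mul1r big1 ?addr0 // => v hv.
have [Svj|/sD->] := boolP (Spt v j); last by rewrite mulr0.
rewrite (@Vortho _ _ j) // (negbTE (_ : i != v)) ?mul0r //.
by apply: contra hv => /eqP h; apply/eqP/val_inj.
Qed.

Lemma ip_on_supp D X Y : supp Spt D ->
  (forall i j, (i < np)%N -> Spt i j -> X i j = Y i j) ->
  ip np nt D X = ip np nt D Y.
Proof.
move=> sD h; apply: eq_bigr => i _; apply: eq_bigr => j _.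
by have [S|/sD->] := boolP (Spt i j); [rewrite h | rewrite !mul0r].
Qed.

Lemma n2_mulm_ortho D : supp Spt D -> n2 nq nt (mulm np V D) = n2 np nt D.
Proof.
move=> sD; rewrite !n2_Re ip_adj; congr complex.Re.
by apply: ip_on_supp => // i j ip S; apply: adj_mulmK.
Qed.

(** Multiplication by [V] is isometric on [Spt], and [V^*] brings any competitor of [V M] back to a
    competitor of [M] that is at least as good. *)
Lemma opt_lift M X Y : supp Spt M ->
  opt np ns nt Sps Sst M X Y ->
  opt nq ns nt Sqs Sst (mulm np V M) (mulm np V X) Y.
Proof.
move=> sM [sX sY oXY]; split=> // [|F G sF sG]; first exact: supp_mulm sV sX.
(* The left factor [V^* F], cut to its support; by [key], the entries cut off do not contribute at
   positions in [Spt]. *)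
pose H : mx R := fun i u => (Sps i u)%:R * mulm nq (adj V) F i u.
have sH : supp Sps H by move=> i u /negbTE h; rewrite /H h mul0r.
have sT : supp Spt (subm M (mulm ns H G)).
  by apply: supp_subm => //; apply: supp_mulm sH sG.
rewrite -mulmA -mulmBr n2_mulm_ortho; last first.
  by apply: supp_subm => //; apply: supp_mulm sX sY.
apply: le_trans (oXY _ _ sH sG) _.
set T := subm M (mulm ns H G); set Z := subm _ _.
have TZ i j : (i < np)%N -> Spt i j -> mulm nq (adj V) Z i j = T i j.
  move=> ip Sij; rewrite /Z mulmBr /subm /T /subm adj_mulmK //; congr (_ - _).
  rewrite mulmA; apply: eq_bigr => u _; rewrite /H.
  have [Siu|nSiu] := boolP (Sps i u); first by rewrite mul1r.
  rewrite mul0r; have [Suj|/sG->] := boolP (Sst u j); last by rewrite !mulr0.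
  suff -> : mulm nq (adj V) F i u = 0 by [].
  rewrite /mulm big1 // => k _; rewrite /adj.
  have [Ski|/sV->] := boolP (Sqp k i); last by rewrite conjc0 mul0r.
  have [Sku|/sF->] := boolP (Sqs k u); last by rewrite mulr0.
  by case/negP: nSiu; apply: key Ski Sku Sij Suj.
(* As [V^* Z = T] on [Spt], this nonnegative number equals [n2 Z - n2 T]. *)
have := n2_ge0 nq nt (subm (mulm np V T) Z).
rewrite n2B ip_adj (ip_on_supp sT TZ) -n2_Re (n2_mulm_ortho sT).
lra.
Qed.

End Projection.

(** * Index levels of a chainable architecture *)

Section Levels.
Local Open Scope nat_scope.

Lemma star_spec p1 p2 : pattern_pos p1 -> pattern_pos p2 ->
  pa p1 %| pa p2 -> pd p2 %| pd p1 ->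
  [/\ pattern_pos (star p1 p2), prows (star p1 p2) = prows p1 &
      pcols (star p1 p2) = pcols p2].
Proof.
case: p1 p2 => [a1 b1 c1 d1] [a2 b2 c2 d2]; rewrite /pattern_pos /prows /pcols /=.
move=> /and4P[a1p b1p c1p d1p] /and4P[a2p b2p c2p d2p] da dd.
have db : d2 %| b1 * d1 by apply: dvdn_mull.
have dc : a1 %| a2 * c2 by apply: dvdn_mulr.
split; last 1 first.
- by rewrite [a1 * _]mulnC divnK.
- by rewrite a1p d2p !divn_gt0 //= (dvdn_leq _ db) ?(dvdn_leq _ dc) ?muln_gt0 ?b1p ?a2p.
- by rewrite -mulnA divnK // mulnA.
Qed.

(** Writing the block lengths as quotients shows that the support depends only on the two sizes, on
    [pa] and on [pd]. *)
Lemma Sb_sizes p i j : pattern_pos p -> Sb p i j =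
  [&& i < prows p, j < pcols p,
      i %/ (prows p %/ pa p) == j %/ (pcols p %/ pa p) & i == j %[mod pd p]].
Proof.
case: p => [a b c d]; rewrite /pattern_pos /Sb /prows /pcols /= => /and4P[ap _ _ _].
by rewrite -!mulnA !mulKn.
Qed.

Variable beta : seq pattern.
Hypothesis chain : chainable_arch beta.
Local Notation L := (size beta).

(* Level [k] is the index set between the factors [k] and [k.+1]. *)
Definition lvl k := if k is 0 then prows (pi_ beta 1) else pcols (pi_ beta k).
(** [la] is read from the pattern after the level and [ld] from the one before it: these are the
    outer parameters that survive in an iterated product starting, respectively ending, at that
    level. *)
Definition la k := pa (pi_ beta k.+1).
Definition ld k := pd (pi_ beta k).
Definition tp p k i := i %/ (lvl k %/ la p).
(** Support of the iterated product of the patterns [p+1] to [q]; it involves the end levels only,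
    so every bracketing gives the same support. *)
Definition Sl p q i j :=
  [&& i < lvl p, j < lvl q, tp p p i == tp p q j & i == j %[mod ld q]].

Lemma pi_pos k : 0 < k <= L -> pattern_pos (pi_ beta k).
Proof.
case: k => // k /andP[_ kL]; case: chain => -[_ /(all_nthP pat0) h _] _.
exact: h.
Qed.

Lemma lvlE k : k < L -> lvl k = prows (pi_ beta k.+1).
Proof. by case: k => // k kL; case: chain => -[_ _ h] _; apply: h. Qed.

Lemma pi_chain k : 0 < k < L -> chainable (pi_ beta k) (pi_ beta k.+1).
Proof. by case: k => // k kL; case: chain => _ h; apply: h. Qed.

Lemma la_dvd p p' : p <= p' -> p' < L -> la p %| la p'.
Proof.
elim: p' => [|p' IH]; first by rewrite leqn0 => /eqP->.
rewrite leq_eqVlt => /orP[/eqP->//|pp] pL; apply: dvdn_trans (IH pp (ltnW pL)) _.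
by have /and5P[] := @pi_chain p'.+1 pL.
Qed.

Lemma ld_dvd q q' : 0 < q -> q <= q' -> q' <= L -> ld q' %| ld q.
Proof.
move=> q0; elim: q' => [|q' IH]; first by rewrite leqn0 => /eqP->.
rewrite leq_eqVlt => /orP[/eqP->//|qq] qL; apply: dvdn_trans (IH qq (ltnW qL)).
by have /and5P[] := @pi_chain q' (introT andP (conj (leq_trans q0 qq) qL)).
Qed.

Lemma pint_spec p q : p < q -> q <= L -> let x := pint beta p.+1 q in
  [/\ pattern_pos x, pa x = la p, pd x = ld q, prows x = lvl p & pcols x = lvl q].
Proof.
elim: q => // q IH pq qL; rewrite /=; move: pq; rewrite ltnS leq_eqVlt => /orP[/eqP pq|pq].
  by rewrite -pq /pint subnn /= lvlE ?pi_pos // pq.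
have -> : pint beta p.+1 q.+1 = star (pint beta p.+1 q) (pi_ beta q.+1).
  by rewrite /pint subSn // -[(q - _).+1]addn1 iotaD map_cat foldl_cat /= addSn subnKC.
have [x0 xa xd xr xc] := IH pq (ltnW qL).
have [||s0 sr sc] := star_spec x0 (pi_pos (qL : 0 < q.+1 <= L)).
- by rewrite xa; apply: la_dvd; rewrite ?(ltnW pq).
- by rewrite xd; apply: ld_dvd; rewrite ?(leq_ltn_trans _ pq).
by split=> //; rewrite ?sr ?sc //= xa.
Qed.

Lemma Sb_pint p q : p < q -> q <= L -> Sb (pint beta p.+1 q) = Sl p q.
Proof.
move=> pq qL; have [x0 xa xd xr xc] := pint_spec pq qL.
by apply/funext => i; apply/funext => j; rewrite Sb_sizes // xa xd xr xc.
Qed.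

Lemma lvl_gt0 k : k <= L -> 0 < lvl k.
Proof.
have L0 : 0 < L by case: chain => -[]; case: (beta).
case: k => [|k] kL; [have := @pi_pos 1 L0|have := @pi_pos k.+1 kL];
  by rewrite /prows /pcols => /and4P[*]; rewrite !muln_gt0 -andbA; apply/and3P.
Qed.

Lemma la_gt0 p : p < L -> 0 < la p.
Proof. by move=> pL; have /and4P[] := @pi_pos p.+1 pL. Qed.
Lemma ld_gt0 q : 0 < q <= L -> 0 < ld q.
Proof. by move=> pL; have /and4P[] := pi_pos pL. Qed.

Lemma dvd_left p q : p < q -> q <= L -> la p * ld q %| lvl p.
Proof.
move=> pq qL; have [_ <- <- <- _] := pint_spec pq qL.
by rewrite /prows mulnAC dvdn_mulr.
Qed.
Lemma dvd_right p q : p < q -> q <= L -> la p * ld q %| lvl q.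
Proof.
move=> pq qL; have [_ <- <- _ <-] := pint_spec pq qL.
by rewrite /pcols mulnAC dvdn_mulr.
Qed.
(** Integrality of [r]: the level has [a_s c_s d_s] indices and [a_(s+1)] divides [a_s c_s]. The
    quotient is the common size [r] of the classes at level [s]. *)
Lemma dvd_mid s : 0 < s < L -> la s * ld s %| lvl s.
Proof.
case: s => // s sL; have /and5P[h _ _ _ _] := pi_chain sL.
exact: dvdn_mul.
Qed.

Lemma la_dvd_lvl p k : p < L -> p <= k <= L -> la p %| lvl k.
Proof.
move=> pL /andP[pk kL]; move: pk; rewrite leq_eqVlt => /orP[/eqP<-|pk].
  exact: dvdn_trans (dvdn_mulr _ (dvdnn _)) (dvd_left pL (leqnn L)).
exact: dvdn_trans (dvdn_mulr _ (dvdnn _)) (dvd_right pk kL).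
Qed.

(** The coarser block number is the finer one divided by [la p' / la p], whatever the level of the
    index. *)
Lemma tp_mono p p' k l i j : p <= p' < L -> p' <= k <= L -> p' <= l <= L ->
  tp p' k i = tp p' l j -> tp p k i = tp p l j.
Proof.
move=> /andP[pp pL] hk hl; have d := la_dvd pp pL.
have a0 := la_gt0 (leq_ltn_trans pp pL).
suff tpE x y : p' <= x <= L -> tp p x y = tp p' x y %/ (la p' %/ la p).
  by rewrite !tpE // => ->.
move=> hx; rewrite /tp -divnMA; congr (_ %/ _).
by rewrite muln_divA // divnK //; apply: la_dvd_lvl.
Qed.

Lemma mod_mono q q' i j : 0 < q <= q' -> q' <= L ->
  i == j %[mod ld q] -> i == j %[mod ld q'].
Proof.
move=> /andP[q0 qq] qL /eqP h; apply/eqP; have d := ld_dvd q0 qq qL.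
by rewrite -(modn_dvdm i d) h modn_dvdm.
Qed.

Lemma Sl_bound p q i j : Sl p q i j -> (i < lvl p) && (j < lvl q).
Proof. by case/and4P=> -> ->. Qed.

Lemma tp_lt p k i : p < L -> p <= k <= L -> i < lvl k -> tp p k i < la p.
Proof.
move=> pL hk ik; have d := la_dvd_lvl pL hk.
have k0 : 0 < lvl k by apply: leq_ltn_trans ik.
by rewrite /tp ltn_divLR ?divn_gt0 ?la_gt0 ?(dvdn_leq k0) // mulnC divnK.
Qed.

(* An index of level [k] with prescribed block number [x] and residue. *)
Definition rp p k x y := x * (lvl k %/ la p) + y.

Lemma rp_spec p q k x y : p < L -> 0 < q <= L -> p <= k <= L ->
  la p * ld q %| lvl k -> x < la p -> y < ld q ->
  [/\ rp p k x y < lvl k, tp p k (rp p k x y) = x & rp p k x y = y %[mod ld q]].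
Proof.
move=> pL qL hk d xa yd; have a0 := la_gt0 pL.
have kL : k <= L by case/andP: hk.
have k0 := lvl_gt0 kL; have da := la_dvd_lvl pL hk.
have dd : ld q %| lvl k %/ la p by rewrite dvdn_divRL // mulnC.
set w := lvl k %/ la p; have w0 : 0 < w by rewrite divn_gt0 ?(dvdn_leq k0).
have yw : y < w by apply: leq_trans yd (dvdn_leq w0 dd).
split; rewrite /tp /rp -/w.
- have -> : lvl k = la p * w by rewrite mulnC divnK.
  apply: (@leq_trans (x.+1 * w)); [by rewrite mulSn; lia|by rewrite leq_mul2r xa orbT].
- by rewrite divnMDl // divn_small ?addn0.
- by case/dvdnP: dd => z; rewrite -/w => ->; rewrite mulnA modnMDl.
Qed.

(** * Composition of supports and equivalence classes across three levels *)

Section ThreeLevels.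
Variables p s t : nat.
Hypotheses (ps : p < s) (st : s < t) (tL : t <= L).

Let sL : 0 < s < L.
Proof. by rewrite (leq_ltn_trans _ ps) // (leq_trans st). Qed.
Let pL : p < L.
Proof. by apply: ltn_trans ps _; case/andP: sL. Qed.

Lemma tp_down k l i j : s <= k <= L -> s <= l <= L ->
  tp s k i = tp s l j -> tp p k i = tp p l j.
Proof. by move=> hk hl; apply: tp_mono => //; rewrite (ltnW ps); case/andP: sL. Qed.

Lemma mod_up i j : i == j %[mod ld s] -> i == j %[mod ld t].
Proof. by apply: mod_mono => //; rewrite (ltnW st) andbT; case/andP: sL. Qed.

Let ss : s <= s <= L.
Proof. by rewrite leqnn ltnW //; case/andP: sL. Qed.
Let stL : s <= t <= L.
Proof. by rewrite (ltnW st). Qed.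

Lemma Sl_comp i u j : Sl p s i u -> Sl s t u j -> Sl p t i j.
Proof.
move=> /and4P[ip us /eqP h1 h2] /and4P[_ jt /eqP h3 h4]; apply/and4P; split=> //.
  by rewrite h1; apply/eqP; apply: tp_down h3.
by apply/eqP; rewrite -(eqP h4); apply/eqP; apply: mod_up.
Qed.

Lemma Sl_left_ex u : u < lvl s -> exists i, Sl p s i u.
Proof.
move=> us; exists (rp p p (tp p s u) (u %% ld s)).
have [||||||h1 h2 h3] := @rp_spec p s p (tp p s u) (u %% ld s) => //.
- by case/andP: sL => -> /ltnW.
- by rewrite leqnn ltnW.
- by apply: dvd_left => //; case/andP: ss.
- by apply: tp_lt => //; rewrite (ltnW ps); case/andP: ss.
- by rewrite ltn_mod ld_gt0 //; case/andP: sL => -> /ltnW.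
by apply/and4P; split=> //; apply/eqP => //; rewrite h3 modn_mod.
Qed.

Lemma Sl_right_ex u : u < lvl s -> exists j, Sl s t u j.
Proof.
move=> us; exists (rp s t (tp s s u) (u %% ld t)).
have t0 : 0 < t <= L by rewrite tL (leq_ltn_trans _ st).
have sL' : s < L by case/andP: sL.
have [||||||h1 h2 h3] := @rp_spec s t t (tp s s u) (u %% ld t) => //.
- exact: dvd_right.
- exact: tp_lt.
- by rewrite ltn_mod ld_gt0.
by apply/and4P; split=> //; apply/eqP => //; rewrite h3 modn_mod.
Qed.

(** The equivalence of columns read on level [s] alone; by [simc_cls] it is the same for all outer
    levels [p] and [t]. *)
Definition cls u v := (tp s s u == tp s s v) && (u == v %[mod ld s]).

Lemma Sl_cls i u j v : Sl p s i u -> Sl s t u j -> v < lvl s ->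
  Sl p s i v && Sl s t v j = cls u v.
Proof.
move=> /and4P[ip us /eqP h1 /eqP h2] /and4P[_ jt /eqP h3 /eqP h4] vs.
rewrite /Sl ip jt vs /cls /= h2 -h3; apply/idP/idP.
  by case/andP=> /andP[_ ->] /andP[/eqP-> _]; rewrite eqxx.
case/andP=> /eqP h5 /eqP h6; rewrite h6 h5 !eqxx /= andbT h1.
rewrite (tp_down _ _ h5) ?eqxx //=.
by rewrite -h4; apply: mod_up; rewrite h6.
Qed.

Lemma inR_Sl u i : u < lvl s -> inR (lvl p) (lvl t) (Sl p s) (Sl s t) u i = Sl p s i u.
Proof.
move=> us; rewrite /inR; apply/idP/idP.
  by case/andP=> _ /existsP[j /andP[]].
move=> S; have [j Sj] := Sl_right_ex us; case/andP: (Sl_bound S) => -> _ /=.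
case/andP: (Sl_bound Sj) => _ jt; apply/existsP; exists (Ordinal jt).
by rewrite /Ub S Sj.
Qed.

Lemma inC_Sl u j : u < lvl s -> inC (lvl p) (lvl t) (Sl p s) (Sl s t) u j = Sl s t u j.
Proof.
move=> us; rewrite /inC; apply/idP/idP.
  by case/andP=> _ /existsP[i /andP[]].
move=> S; have [i Si] := Sl_left_ex us; case/andP: (Sl_bound S) => _ -> /=.
case/andP: (Sl_bound Si) => ip _; apply/existsP; exists (Ordinal ip).
by rewrite /Ub S Si.
Qed.

Lemma simc_cls u v : u < lvl s -> v < lvl s ->
  simc (lvl p) (lvl t) (Sl p s) (Sl s t) u v = cls u v.
Proof.
move=> us vs; have [i Si] := Sl_left_ex us; have [j Sj] := Sl_right_ex us.
have [ip _] := andP (Sl_bound Si); have [_ jt] := andP (Sl_bound Sj).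
rewrite /simc; apply/forallP/idP.
  move=> /(_ (Ordinal ip)) /forallP /(_ (Ordinal jt)) /eqP.
  by rewrite /Ub /= Si Sj /= => h; rewrite -(Sl_cls Si Sj vs) -h.
move=> /andP[c1 c2] i'; apply/forallP => j'; apply/eqP; rewrite /Ub /Sl us vs /=.
by rewrite (eqP c2) (eqP c1) (tp_down _ _ (eqP c1)) // (eqP (mod_up c2)).
Qed.

End ThreeLevels.

(** The residues of [i] and [u] are compared through the row [k], their block numbers through the
    column [j]. *)
Lemma Sl_key q p s t k i u j : q < p -> p < s -> s < t -> t <= L ->
  Sl q p k i -> Sl q s k u -> Sl p t i j -> Sl s t u j -> Sl p s i u.
Proof.
move=> qp ps st tL /and4P[_ ip _ h1] /and4P[_ us _ h2]
  /and4P[_ _ /eqP h3 _] /and4P[_ _ /eqP h4 _].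
apply/and4P; split=> //.
  rewrite h3 eq_sym; apply/eqP; apply: (tp_down ps st tL _ _ h4).
    by rewrite leqnn ltnW // (leq_trans st).
  by rewrite (ltnW st).
by rewrite -(eqP h2) eq_sym; apply: (mod_up qp ps _ h1); apply: ltnW (leq_trans st tL).
Qed.

Lemma Sl_key_tr p s t q k i u j : p < s -> s < t -> t < q -> q <= L ->
  Sl t q i k -> Sl s q u k -> Sl p t j i -> Sl p s j u -> Sl s t u i.
Proof.
move=> ps st tq qL /and4P[ip _ /eqP h1 _] /and4P[us _ /eqP h2 _]
  /and4P[_ _ _ h3] /and4P[_ _ _ h4].
apply/and4P; split=> //.
  rewrite h2 eq_sym; apply/eqP; apply: (tp_down st tq qL _ _ h1).
    by rewrite leqnn ltnW // (leq_trans tq).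
  by rewrite (ltnW tq).
by rewrite -(eqP h3) eq_sym; apply: (mod_up ps st _ h4); apply: ltnW (leq_trans tq qL).
Qed.

End Levels.

(** * Specification of the elementary steps *)

Section Steps.
Variable R : realType.
Local Notation C := R[i].
Implicit Types (X Y Z V W M F G H K : mx R).

(** Supports and classes are abstract so that the row version is this one applied to transposes. The
    product is preserved because [(Q R) Y = Q (R Y)] inside each class. *)
Lemma ortho_spec m r (SL SR cl : nat -> nat -> bool) (X Y X' Y' Q Rm : mx R) :
  (forall i s, SL i s -> (i < m)%N && (s < r)%N) ->
  (forall s j, SR s j -> (s < r)%N) ->
  (forall u, cl u u) -> (forall u v, cl u v = cl v u) ->
  (forall i u v, (u < r)%N -> (v < r)%N -> cl u v -> SL i u = SL i v) ->
  (forall j u v, (u < r)%N -> (v < r)%N -> cl u v -> SR u j = SR v j) ->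
  supp SL X -> supp SR Y ->
  (forall i s, SL i s -> X i s = \sum_(u < r | cl u s) Q i u * Rm u s) ->
  (forall s u, (s < r)%N -> (u < r)%N -> cl s u ->
    \sum_(i < m | SL i u) conjc (Q i s) * Q i u = (s == u)%:R) ->
  (forall i s, X' i s = if (s < r)%N && SL i s then Q i s else 0) ->
  (forall s j, Y' s j = if (s < r)%N && SR s j
      then \sum_(u < r | cl u s) Rm s u * Y u j else 0) ->
  [/\ supp SL X', supp SR Y', mulm r X' Y' = mulm r X Y &
    forall s u, (s < r)%N -> (u < r)%N -> cl s u ->
      \sum_(i < m) conjc (X' i s) * X' i u = (s == u)%:R].
Proof.
move=> bL bR clxx clC clL clR sX sY XE QO X'E Y'E; split.
- by move=> i s /negbTE h; rewrite X'E h andbF.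
- by move=> s j /negbTE h; rewrite Y'E h andbF.
- have X'R i v : (v < r)%N -> X i v = \sum_(u < r | cl u v) X' i u * Rm u v.
    move=> vr; have [S|nS] := boolP (SL i v); last first.
      rewrite sX // big1 // => u uv; rewrite X'E (clL i u v) // (negbTE nS) andbF.
      by rewrite mul0r.
    by rewrite XE //; apply: eq_bigr => u uv; rewrite X'E ltn_ord (clL i u v) // S.
  have Y'R u j : (u < r)%N -> Y' u j = \sum_(v < r | cl v u) Rm u v * Y v j.
    move=> ur; rewrite Y'E ur /=; case: ifP => // /negbT nS.
    by rewrite big1 // => v uv; rewrite sY ?mulr0 // (clR j v u).
  apply: mxext => i j; rewrite /mulm.
  rewrite [RHS](eq_bigr (fun v : 'I_r => \sum_(u < r | cl u v) X' i u * (Rm u v * Y v j))).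
    rewrite [RHS](exchange_big_dep xpredT) //=; apply: eq_bigr => u _.
    by rewrite Y'R // mulr_sumr; apply: eq_big => // v; apply: clC.
  by move=> v _; rewrite X'R // mulr_suml; apply: eq_bigr => u _; rewrite mulrA.
move=> s u sr ur su; rewrite -QO // [RHS]big_mkcond; apply: eq_bigr => i _.
by rewrite !X'E sr ur (clL i s u) //=; case: ifP; rewrite ?mulr0.
Qed.

Variable beta : seq pattern.
Hypothesis chain : chainable_arch beta.
Local Notation L := (size beta).
Local Notation lvl := (lvl beta).
Local Notation tp := (tp beta).
Local Notation ld := (ld beta).
Local Notation Sl := (Sl beta).

(** Stronger than orthonormality inside a class: two rows of a factor to the right that share a
    column agree in block number only, and this is the range that [opt_lift] needs. [rowo] is the
    mirror image, with residues. *)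
Definition colo q p V := forall i i', (i < lvl p)%N -> (i' < lvl p)%N ->
  tp p p i = tp p p i' -> \sum_(k < lvl q) conjc (V k i) * V k i' = (i == i')%:R.
Definition rowo t q W := forall i i', (i < lvl t)%N -> (i' < lvl t)%N ->
  i = i' %[mod ld t] -> \sum_(k < lvl q) conjc (W i k) * W i' k = (i == i')%:R.

Lemma clsxx s u : cls beta s u u.
Proof. by rewrite /cls !eqxx. Qed.
Lemma clsC s u v : cls beta s u v = cls beta s v u.
Proof. by rewrite /cls eq_sym [(u %% _)%N == _]eq_sym. Qed.

Section ThreeLevelSteps.
Variables p s t : nat.
Hypotheses (ps : (p < s)%N) (st : (s < t)%N) (tL : (t <= L)%N).

Let s_gt0 : (0 < s)%N. Proof. exact: leq_ltn_trans ps. Qed.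
Let s_ltL : (s < L)%N. Proof. exact: leq_trans tL. Qed.
Let ss : (s <= s <= L)%N. Proof. by rewrite leqnn ltnW. Qed.
Let stL : (s <= t <= L)%N. Proof. by rewrite (ltnW st). Qed.

Lemma cls_left i u v : (u < lvl s)%N -> (v < lvl s)%N -> cls beta s u v ->
  Sl p s i u = Sl p s i v.
Proof.
move=> us vs /andP[/eqP c1 /eqP c2]; by rewrite /Sl us vs c2 (tp_down chain ps st tL _ _ c1).
Qed.
Lemma cls_right j u v : (u < lvl s)%N -> (v < lvl s)%N -> cls beta s u v ->
  Sl s t u j = Sl s t v j.
Proof.
move=> us vs /andP[/eqP c1 c2]; rewrite /Sl us vs c1 /=.
by rewrite (eqP (mod_up chain ps st tL c2)).
Qed.

Lemma ortho_col_spec X Y X' Y' : supp (Sl p s) X -> supp (Sl s t) Y ->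
  ortho_col_rel (lvl p) (lvl s) (lvl t) (Sl p s) (Sl s t) X Y X' Y' ->
  [/\ supp (Sl p s) X', supp (Sl s t) Y',
      mulm (lvl s) X' Y' = mulm (lvl s) X Y & colo p s X'].
Proof.
move=> sX sY [Q [Rm [h hX' hY']]].
have [||||||||||||sX' sY' e o] := @ortho_spec (lvl p) (lvl s)
  (Sl p s) (Sl s t) (cls beta s) X Y X' Y' Q Rm.
- by move=> i u; apply: Sl_bound.
- by move=> u j /Sl_bound/andP[].
- exact: clsxx.
- exact: clsC.
- exact: cls_left.
- exact: cls_right.
- exact: sX.
- exact: sY.
- move=> i u S; have /andP[_ us] := Sl_bound S; have [h1 _ _] := h u us.
  rewrite h1 ?inR_Sl ?simc_cls ?clsxx //.
  by apply: eq_bigl => v; rewrite simc_cls.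
- move=> u v us vs uv; have [_ h1 _] := h v vs.
  by rewrite -h1 ?simc_cls ?clsxx //; apply: eq_bigl => i; rewrite inR_Sl.
- move=> i u; rewrite hX'; case: (ltnP u (lvl s)) => //= us; by rewrite inR_Sl.
- move=> u j; rewrite hY'; case: (ltnP u (lvl s)) => //= us; rewrite inC_Sl //.
  by case: ifP => // _; apply: eq_bigl => v; rewrite simc_cls.
split=> // i i' il il' ii; have [c|nc] := boolP (cls beta s i i'); first exact: o.
(* In different classes with equal block numbers, the residues differ, so the two columns have
   disjoint supports. *)
have ne : i != i' by apply: contra nc => /eqP->; apply: clsxx.
rewrite (negbTE ne) big1 // => k _.
have [S1|/sX'->] := boolP (Sl p s k i); last by rewrite conjc0 mul0r.
have [S2|/sX'->] := boolP (Sl p s k i'); last by rewrite mulr0.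
case/negP: nc; rewrite /cls ii eqxx /=.
by case/and4P: S1 => _ _ _ /eqP<-; case/and4P: S2.
Qed.

Lemma ortho_row_spec X Y X' Y' : supp (Sl p s) X -> supp (Sl s t) Y ->
  ortho_row_rel (lvl p) (lvl s) (lvl t) (Sl p s) (Sl s t) X Y X' Y' ->
  [/\ supp (Sl p s) X', supp (Sl s t) Y',
      mulm (lvl s) X' Y' = mulm (lvl s) X Y & rowo s t Y'].
Proof.
move=> sX sY [Q [Rm [h hX' hY']]].
have [||||||||||||sY' sX' e o] := @ortho_spec (lvl t) (lvl s)
  (trr (Sl s t)) (trr (Sl p s)) (cls beta s) (trm Y) (trm X) (trm Y') (trm X') Q Rm.
- by move=> i u /Sl_bound /andP[-> ->].
- by move=> u j /Sl_bound/andP[].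
- exact: clsxx.
- exact: clsC.
- by move=> j u v; apply: cls_right.
- by move=> j u v; apply: cls_left.
- exact: supp_tr.
- exact: supp_tr.
- move=> j u S; have /andP[us _] := Sl_bound S; have [h1 _ _] := h u us.
  rewrite /trm h1 ?inC_Sl ?simc_cls ?clsxx //.
  by apply: eq_bigl => v; rewrite simc_cls.
- move=> u v us vs uv; have [_ h1 _] := h v vs.
  by rewrite -h1 ?simc_cls ?clsxx //; apply: eq_bigl => i; rewrite inC_Sl.
- by move=> j u; rewrite /trm /trr hY'; case: (ltnP u (lvl s)) => //= us; rewrite inC_Sl.
- move=> u i; rewrite /trm /trr hX'; case: (ltnP u (lvl s)) => //= us; rewrite inR_Sl //.
  case: ifP => // _; apply: eq_big => [v|v _]; first by rewrite simc_cls.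
  by rewrite mulrC.
have {}sX' : supp (Sl p s) X' by exact: supp_tr sX'.
have {}sY' : supp (Sl s t) Y' by exact: supp_tr sY'.
split=> //.
  by have := congr1 (@trm R) e; rewrite !mulm_tr.
move=> i i' il il' ii; have [c|nc] := boolP (cls beta s i i'); first exact: o.
have ne : i != i' by apply: contra nc => /eqP->; apply: clsxx.
rewrite (negbTE ne) big1 // => k _.
have [S1|/sY'->] := boolP (Sl s t i k); last by rewrite conjc0 mul0r.
have [S2|/sY'->] := boolP (Sl s t i' k); last by rewrite mulr0.
case/negP: nc; rewrite /cls ii eqxx andbT.
by case/and4P: S1 => _ _ /eqP-> _; case/and4P: S2 => _ _ /eqP-> _.
Qed.

(** * From classwise to global optimality *)

Definition maskm (S : nat -> nat -> bool) M : mx R :=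
  fun i j => if S i j then M i j else 0.

(** Singles out one index per class, so that each block is counted once. *)
Definition isrep u := rp beta s s (tp s s u) (u %% ld s) == u.

(** A position of the product support lies in exactly one block: the column fixes the block number
    of its class, the row fixes the residue. *)
Lemma rep_unique i j u : Sl p t i j -> (u < lvl s)%N ->
  [&& isrep u, Sl p s i u & Sl s t u j] =
  (u == rp beta s s (tp s t j) (i %% ld s)).
Proof.
move=> /and4P[ip jt /eqP h1 h2] us; apply/idP/idP.
  case/and3P=> /eqP h5 /and4P[_ _ _ /eqP h3] /and4P[_ _ /eqP h4 _].
  by rewrite -h4 h3 h5.
have [||||||g1 g2 g3] := @rp_spec beta chain s s s (tp s t j) (i %% ld s)%N => //.
- by rewrite s_gt0 ltnW.
- by apply: dvd_mid => //; rewrite s_gt0.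
- exact: tp_lt.
- by rewrite ltn_mod ld_gt0 // s_gt0 ltnW.
set u0 := rp _ _ _ _ _ in g1 g2 g3 *; rewrite modn_mod in g3.
move/eqP->; apply/and3P; split.
- by rewrite /isrep g2 g3.
- apply/and4P; split=> //; last by rewrite g3.
  by rewrite h1 eq_sym; apply/eqP; apply: (tp_down chain ps st tL _ _ g2).
apply/and4P; split=> //; first by rewrite g2.
by rewrite -(eqP h2); apply: (mod_up chain ps st tL); rewrite g3.
Qed.

Lemma n2_blocks M H K : supp (Sl p s) H -> supp (Sl s t) K ->
  n2 (lvl p) (lvl t) (subm (maskm (Sl p t) M) (mulm (lvl s) H K)) =
  \sum_(u < lvl s | isrep u) \sum_(i < lvl p | Sl p s i u) \sum_(j < lvl t | Sl s t u j)
    sqn (M i j - \sum_(v < lvl s | cls beta s v u) H i v * K v j).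
Proof.
move=> sH sK; rewrite [RHS](exchange_big_dep xpredT) //=; apply: eq_bigr => i _.
rewrite [RHS](exchange_big_dep xpredT) //=; apply: eq_bigr => j _.
rewrite /subm /maskm; case: ifP => [Sij|/negbT nS]; last first.
  have -> : mulm (lvl s) H K i j = 0.
    by apply: (@supp_mulm R _ _ _ (Sl p t) _ _ _ sH sK) => // i' u' j'; apply: Sl_comp.
  rewrite subrr sqn0 big_pred0 // => u; apply/negbTE; apply: contra nS.
  by case/andP=> /andP[_ h1]; apply: Sl_comp h1.
have [||||||g1 _ _] := @rp_spec beta chain s s s (tp s t j) (i %% ld s)%N => //.
- by rewrite s_gt0 ltnW.
- by apply: dvd_mid => //; rewrite s_gt0.
- by apply: tp_lt => //; case/and4P: Sij.
- by rewrite ltn_mod ld_gt0 // s_gt0 ltnW.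
rewrite (big_pred1 (Ordinal g1)) => [|u]; last first.
  by rewrite -andbA rep_unique // -val_eqE.
have := rep_unique Sij g1; rewrite eqxx => /and3P[_ S1 S2] /=.
congr (sqn (_ - _)); rewrite [RHS]big_mkcond; apply: eq_bigr => v _.
rewrite clsC -(Sl_cls chain ps st tL S1 S2) //.
have [Siv|/sH->] := boolP (Sl p s i v); last by rewrite mul0r.
by have [Svj|/sK->] := boolP (Sl s t v j); last by rewrite mulr0.
Qed.

(** The blocks partition the support, so the squared error is a sum of independent block errors and
    classwise minima add up. *)
Lemma twofactor_opt M X Y :
  twofactor_rel (lvl p) (lvl s) (lvl t) (Sl p s) (Sl s t) M X Y ->
  opt (lvl p) (lvl s) (lvl t) (Sl p s) (Sl s t) (maskm (Sl p t) M) X Y.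
Proof.
move=> [hX hY hmin].
have sX : supp (Sl p s) X.
  move=> i u nS; apply: hX; rewrite negb_and -implybE; apply/implyP => us.
  by rewrite inR_Sl.
have sY : supp (Sl s t) Y.
  move=> u j nS; apply: hY; rewrite negb_and -implybE; apply/implyP => us.
  by rewrite inC_Sl.
split=> // H K sH sK; rewrite !n2_blocks //; apply: ler_sum => u _.
have := hmin u (ltn_ord u) H K; rewrite /blockres ler_sqrt; last first.
  by do 2!apply: sumr_ge0 => ? _; apply: sqn_ge0.
suff E F G : \sum_(i < lvl p | inR (lvl p) (lvl t) (Sl p s) (Sl s t) u i)
     \sum_(j < lvl t | inC (lvl p) (lvl t) (Sl p s) (Sl s t) u j)
        sqn (M i j - \sum_(s0 < lvl s | simc (lvl p) (lvl t) (Sl p s) (Sl s t) s0 u)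
                        F i s0 * G s0 j) =
   \sum_(i < lvl p | Sl p s i u) \sum_(j < lvl t | Sl s t u j)
     sqn (M i j - \sum_(v < lvl s | cls beta s v u) F i v * G v j) by rewrite !E.
apply: eq_big => [i|i _]; first by rewrite inR_Sl.
apply: eq_big => [j|j _]; first by rewrite inC_Sl.
by congr (sqn (_ - _)); apply: eq_bigl => v; rewrite simc_cls.
Qed.

End ThreeLevelSteps.

Lemma opt_lift_left q p s t V M X Y :
  (q < p)%N -> (p < s)%N -> (s < t)%N -> (t <= L)%N ->
  supp (Sl q p) V -> colo q p V -> supp (Sl p t) M ->
  opt (lvl p) (lvl s) (lvl t) (Sl p s) (Sl s t) M X Y ->
  opt (lvl q) (lvl s) (lvl t) (Sl q s) (Sl s t) (mulm (lvl p) V M) (mulm (lvl p) V X) Y.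
Proof.
move=> qp ps st tL sV oV sM; apply: (@opt_lift _ _ _ _ _ (Sl q p)) sM => //.
- by move=> k i u; apply: Sl_comp => //; apply: ltnW (leq_trans st tL).
- by move=> k i u; apply: Sl_comp.
- by move=> k i u j; apply: Sl_key.
move=> i i' j /and4P[il _ /eqP h _] /and4P[il' _ /eqP h' _]; apply: oV => //.
by rewrite h h'.
Qed.

Lemma opt_lift_right p s t q W M X Y :
  (p < s)%N -> (s < t)%N -> (t < q)%N -> (q <= L)%N ->
  supp (Sl t q) W -> rowo t q W -> supp (Sl p t) M ->
  opt (lvl p) (lvl s) (lvl t) (Sl p s) (Sl s t) M X Y ->
  opt (lvl p) (lvl s) (lvl q) (Sl p s) (Sl s q) (mulm (lvl t) M W) X (mulm (lvl t) Y W).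
Proof.
move=> ps st tq qL sW oW sM /opt_tr o.
suff /opt_tr : opt (lvl q) (lvl s) (lvl p) (trr (Sl s q)) (trr (Sl p s))
    (mulm (lvl t) (trm W) (trm M)) (mulm (lvl t) (trm W) (trm Y)) (trm X).
  by rewrite !mulm_tr.
apply: (@opt_lift _ _ _ _ _ (trr (Sl t q)) _ _ (trr (Sl p t))) o => //.
- by move=> k i u h1 h2; apply: Sl_comp h2 h1.
- by move=> k i u h1 h2; apply: Sl_comp h2 h1 => //; apply: ltnW (leq_trans tq qL).
- by move=> k i u j; apply: Sl_key_tr.
- exact: supp_tr.
- move=> i i' j /and4P[_ il _ /eqP h] /and4P[_ il' _ /eqP h']; apply: oW => //.
  by rewrite -h.
- exact: supp_tr.
Qed.

End Steps.

(** * Error analysis *)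

Section Errors.
Variable R : realType.
Variable beta : seq pattern.
Hypothesis chain : chainable_arch beta.
Local Notation L := (size beta).
Local Notation lvl := (lvl beta).
Local Notation Sl := (Sl beta).
Implicit Types (A B F G H K Z : mx R).

(** One split seen on full products alone; the error analysis never looks at the individual factors
    of a state. *)
Definition stepB s B B' := exists F G,
  opt (lvl 0) (lvl s) (lvl L) (Sl 0 s) (Sl s L) B F G /\ B' = mulm (lvl s) F G.

Definition approx2 (e2 : R) s B := exists F G, [/\ supp (Sl 0 s) F, supp (Sl s L) G &
  n2 (lvl 0) (lvl L) (subm B (mulm (lvl s) F G)) <= e2].

Lemma iter_rel_cat (S : Type) (s1 s2 : seq nat) (Rel : nat -> S -> S -> Prop) x z :
  iter_rel (s1 ++ s2) Rel x z <->
  exists y, iter_rel s1 Rel x y /\ iter_rel s2 Rel y z.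
Proof.
elim: s1 x => [|k s1 IH] x /=; first by split=> [h|[y [-> h]]] //; exists x.
split=> [[w [h1 /IH[y [h2 h3]]]]|[y [[w [h1 h2]] h3]]].
  by exists y; split=> //; exists w.
by exists w; split=> //; apply/IH; exists y.
Qed.

Lemma iter_rel_rcons (S : Type) (s : seq nat) k (Rel : nat -> S -> S -> Prop) x z :
  iter_rel (rcons s k) Rel x z <-> exists y, iter_rel s Rel x y /\ Rel k y z.
Proof.
rewrite -cats1 iter_rel_cat; split=> -[y [h1 h2]]; exists y; split=> //.
  by case: h2 => w [h <-].
by exists z.
Qed.

Lemma iota_rcons m n : iota m n.+1 = rcons (iota m n) (m + n)%N.
Proof. by rewrite -addn1 iotaD cats1. Qed.

Lemma stepB_supp s B B' : (0 < s < L)%N -> stepB s B B' -> supp (Sl 0 L) B'.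
Proof.
move=> /andP[s0 sL] [F [G [[sF sG _] ->]]]; apply: supp_mulm sF sG => i u j.
exact: Sl_comp.
Qed.

Lemma stepB_project s' s B B' F G : (0 < s')%N -> (s' < s)%N -> (s < L)%N ->
  stepB s B B' -> supp (Sl 0 s') F -> supp (Sl s' L) G ->
  exists F0 G0 h, [/\ opt (lvl 0) (lvl s) (lvl L) (Sl 0 s) (Sl s L) B F0 G0,
    B' = mulm (lvl s) F0 G0, supp (Sl s' s) h &
    n2 (lvl 0) (lvl L) (subm B' (mulm (lvl s') F (mulm (lvl s) h G0)))
      <= n2 (lvl 0) (lvl L) (subm B (mulm (lvl s') F G))].
Proof.
move=> s0 ss sL [F0 [G0 [o ->]]] sF sG; exists F0, G0; case: (o) => sF0 sG0 _.
have c1 k i u : Sl 0 s' k i -> Sl s' s i u -> Sl 0 s k u.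
  by apply: Sl_comp => //; apply: ltnW.
have c2 i u j : Sl s' s i u -> Sl s L u j -> Sl s' L i j by apply: Sl_comp.
have c3 k i u j : Sl 0 s' k i -> Sl 0 s k u -> Sl s' L i j -> Sl s L u j -> Sl s' s i u.
  exact: Sl_key.
have orth H : supp (Sl 0 s) H ->
    ip (lvl 0) (lvl L) (subm B (mulm (lvl s) F0 G0)) (mulm (lvl s) H G0) = 0.
  exact: opt_orthl o.
have [h [sh hle]] := best_factor_projects (lvl s') c1 c2 c3 sF0 sG0 sF sG orth.
by exists h.
Qed.

Lemma stepB_project_tr s' s B B' F G : (0 < s)%N -> (s < s')%N -> (s' < L)%N ->
  stepB s B B' -> supp (Sl 0 s') F -> supp (Sl s' L) G ->
  exists F0 h, [/\ supp (Sl 0 s) F0, supp (Sl s s') h &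
    n2 (lvl 0) (lvl L) (subm B' (mulm (lvl s') (mulm (lvl s) F0 h) G))
      <= n2 (lvl 0) (lvl L) (subm B (mulm (lvl s') F G))].
Proof.
move=> s0 ss sL [F0 [G0 [o ->]]] sF sG; case: (o) => sF0 sG0 _.
have c1 k i u : trr (Sl s' L) k i -> trr (Sl s s') i u -> trr (Sl s L) k u.
  by move=> h1 h2; apply: Sl_comp h2 h1.
have c2 i u j : trr (Sl s s') i u -> trr (Sl 0 s) u j -> trr (Sl 0 s') i j.
  by move=> h1 h2; apply: Sl_comp h2 h1 => //; apply: ltnW.
have c3 k i u j : trr (Sl s' L) k i -> trr (Sl s L) k u -> trr (Sl 0 s') i j ->
    trr (Sl 0 s) u j -> trr (Sl s s') i u by apply: Sl_key_tr.
have orth H : supp (trr (Sl s L)) H -> ip (lvl L) (lvl 0)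
    (subm (trm B) (mulm (lvl s) (trm G0) (trm F0))) (mulm (lvl s) H (trm F0)) = 0.
  by move=> sH; apply: opt_orthl (opt_tr o) sH.
have [h [sh hle]] := best_factor_projects (lvl s') c1 c2 c3
  (supp_tr sG0) (supp_tr sF0) (supp_tr sG) (supp_tr sF) orth.
exists F0, (trm h); split=> //; first exact: supp_tr sh.
rewrite -[X in _ <= X]n2_tr -n2_tr; move: hle.
rewrite -[trm (subm B _)]/(subm (trm B) (trm (mulm _ _ _))).
by rewrite -[trm (subm _ _)]/(subm (trm (mulm _ _ _)) (trm (mulm _ _ _))) !mulm_tr.
Qed.

(** For [s' < s] the competitor keeps its left factor, for [s' > s] its right one, and the other is
    projected. For [s' = s] the new product is its own competitor, with error zero. *)
Lemma approx2_step e2 s s' B B' : 0 <= e2 -> (0 < s < L)%N -> (0 < s' < L)%N ->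
  stepB s B B' -> approx2 e2 s' B -> approx2 e2 s' B'.
Proof.
move=> e0 /andP[s0 sL] /andP[s0' sL'] h [F [G [sF sG hle]]].
have [ss|ss|ss] := ltngtP s' s.
- have [F0 [G0 [k [[sF0 sG0 _] _ sk le2]]]] := stepB_project s0' ss sL h sF sG.
  exists F, (mulm (lvl s) k G0); split=> //; last exact: le_trans le2 hle.
  by apply: supp_mulm sk sG0 => i u j; apply: Sl_comp.
- have [F0 [k [sF0 sk le2]]] := stepB_project_tr s0 ss sL' h sF sG.
  exists (mulm (lvl s) F0 k), G; split=> //; last exact: le_trans le2 hle.
  by apply: supp_mulm sF0 sk => i u j; apply: Sl_comp => //; apply: ltnW.
rewrite {}ss; case: h => F0 [G0 [[sF0 sG0 _] ->]]; exists F0, G0; split=> //.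
apply: le_trans e0; rewrite le_eqVlt; apply/orP; left; apply/eqP.
by rewrite /n2 big1 // => i _; rewrite big1 // => j _; rewrite /subm subrr sqn0.
Qed.

Lemma stepB_error e2 s B B' : stepB s B B' -> approx2 e2 s B ->
  n2 (lvl 0) (lvl L) (subm B B') <= e2.
Proof.
case=> F0 [G0 [[sF0 sG0 o] ->]] [F [G [sF sG h]]]; exact: le_trans (o _ _ sF sG) h.
Qed.

Lemma run_error e2 sigma A B : 0 <= e2 -> (forall s, s \in sigma -> (0 < s < L)%N) ->
  (forall s, (0 < s < L)%N -> approx2 e2 s A) -> iter_rel sigma stepB A B ->
  (forall s, (0 < s < L)%N -> approx2 e2 s B) /\
  n2 (lvl 0) (lvl L) (subm A B) <= (size sigma)%:R ^+ 2 * e2.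
Proof.
move=> e0; elim/last_ind: sigma B => [|sigma s IH] B hs hA.
  move=> /= <-; split=> //; rewrite expr0n mul0r /n2 big1 // => i _.
  by rewrite big1 // => j _; rewrite /subm subrr sqn0.
case/iter_rel_rcons=> B1 [run1 step].
have hs0 : (0 < s < L)%N by apply: hs; rewrite mem_rcons mem_head.
have [|hB1 n1] := IH B1 _ hA run1.
  by move=> s' h; apply: hs; rewrite mem_rcons in_cons h orbT.
split=> [s' hs'|]; first exact: approx2_step hs0 hs' step (hB1 _ hs').
have n2' := stepB_error step (hB1 _ hs0).
have -> : subm A B = addm (subm A B1) (subm B1 B).
  by apply: mxext => i j; rewrite /addm /subm; ring.
rewrite size_rcons -natr1; set k : R := (size sigma)%:R in n1 *.
(* The weighted inequality needs a positive weight, so the first split, where [A = B1], is treated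
   apart. *)
have [k0|k0] := eqVneq (size sigma) 0%N.
  have AB : A = B1 by move: run1; rewrite (size0nil k0).
  rewrite /k k0 add0r expr1n mul1r; apply: le_trans n2'.
  rewrite le_eqVlt; apply/orP; left; apply/eqP; apply: eq_n2 => i j _ _.
  by rewrite /addm {1}AB /subm subrr add0r.
have kp : 0 < k by rewrite ltr0n lt0n.
have h := n2_add_amgm (lvl 0) (lvl L) (subm A B1) (subm B1 B) kp.
rewrite -(ler_pM2l kp); apply: le_trans h _.
have -> : k * ((k + 1) ^+ 2 * e2) = (k + 1) * (k ^+ 2 * e2) + k * (k + 1) * e2 by ring.
apply: lerD; apply: ler_wpM2l => //; first lra.
by rewrite mulr_ge0 //; lra.
Qed.

(* The matrices whose column blocks at level [s] lie in the column spaces of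
   those of [B], expressed without reference to a particular factorization. *)
Definition col_related s B Z := forall F G, supp (Sl 0 s) F -> supp (Sl s L) G ->
  B = mulm (lvl s) F G -> exists K, supp (Sl s L) K /\ Z = mulm (lvl s) F K.

(** The case of [stepB_project] where the old distance is zero: the new distance is zero too, so a
    split further right keeps the column blocks inside those of [F]. *)
Lemma stepB_project_eq s' s B B' F G : (0 < s')%N -> (s' < s)%N -> (s < L)%N ->
  stepB s B B' -> supp (Sl 0 s') F -> supp (Sl s' L) G -> B = mulm (lvl s') F G ->
  exists h G0, [/\ supp (Sl s' s) h, supp (Sl s L) G0 &
    B' = mulm (lvl s') F (mulm (lvl s) h G0)].
Proof.
move=> s0 ss sL h sF sG BE.
have [F0 [G0 [k [[sF0 sG0 _] B'E sk hle]]]] := stepB_project s0 ss sL h sF sG.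
exists k, G0; split=> //.
have s1 : (0 < s < L)%N by rewrite sL (leq_ltn_trans _ ss).
apply: (@supp_eq R (lvl 0) (lvl L) (Sl 0 L)) => //.
- by move=> i j /Sl_bound.
- exact: stepB_supp s1 h.
- apply: (@supp_mulm R _ (Sl 0 s') (Sl s' L)) => //.
    by move=> i u j; apply: Sl_comp => //; apply: ltn_trans sL.
  by apply: supp_mulm sk sG0 => i u j; apply: Sl_comp.
apply: le_trans hle _; rewrite BE /n2 big1 // => i _; rewrite big1 // => j _.
by rewrite /subm subrr sqn0.
Qed.

(** Invariant: the accumulated residual is orthogonal to all matrices built on the column blocks of
    the current product at boundary [n]. The next increment is such a matrix, hence Pythagoras; and
    what is built on the next product at boundary [n+1] is also built on the current one at [n], so
    the invariant persists. *)
Lemma run_error_id e2 n A B : 0 <= e2 -> (n < L)%N ->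
  (forall s, (0 < s < L)%N -> approx2 e2 s A) -> iter_rel (iota 1 n) stepB A B ->
  n2 (lvl 0) (lvl L) (subm A B) <= n%:R * e2 /\
  (A = B \/ exists F G, [/\ supp (Sl 0 n) F, supp (Sl n L) G, B = mulm (lvl n) F G &
    (0 < n)%N /\ forall Z, col_related n B Z -> ip (lvl 0) (lvl L) (subm A B) Z = 0]).
Proof.
move=> e0; elim: n B => [|n IH] B nL hA.
  move=> /= <-; split; last by left.
  rewrite mul0r /n2 big1 // => i _.
  by rewrite big1 // => j _; rewrite /subm subrr sqn0.
rewrite iota_rcons add1n => /iter_rel_rcons [B1 [run1 step]].
have [|hB1 _] := @run_error e2 (iota 1 n) A B1 e0 _ hA run1.
  move=> s; rewrite mem_iota add1n => /andP[-> h]; exact: leq_trans h (ltnW nL).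
have [n1 inv] := IH B1 (ltnW nL) hA run1.
have sn : (0 < n.+1 < L)%N by [].
have n2' := stepB_error step (hB1 _ sn).
case: (step) => F0 [G0 [o BE]]; case: (o) => sF0 sG0 _.
have AE : subm A B = addm (subm A B1) (subm B1 B).
  by apply: mxext => i j; rewrite /addm /subm; ring.
have orth2 Z : col_related n.+1 B Z -> ip (lvl 0) (lvl L) (subm B1 B) Z = 0.
  move=> /(_ F0 G0 sF0 sG0 BE) [K [sK ->]]; rewrite BE; exact: opt_orthr o sK.
suff [pyth orth1] : ip (lvl 0) (lvl L) (subm A B1) (subm B1 B) = 0 /\
    forall Z, col_related n.+1 B Z -> ip (lvl 0) (lvl L) (subm A B1) Z = 0.
  split; last first.
    right; exists F0, G0; split=> //; split=> // Z hZ.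
    by rewrite AE ipDl orth1 // orth2 // addr0.
  by rewrite AE n2_pyth // -natr1 mulrDl mul1r lerD.
(* Before any split there is no boundary to refer to, but the residual is zero. *)
case: inv => [<-|[F [G [sF sG B1E [n0 inv]]]]].
  have z0 Z : ip (lvl 0) (lvl L) (subm A A) Z = 0.
    by rewrite /ip big1 // => i _; rewrite big1 // => j _; rewrite /subm subrr mul0r.
  by split=> [|Z _]; apply: z0.
split.
  rewrite ipBr !inv ?subrr // => F' G' sF' sG' E; last by exists G'.
  have [k [K [sk sK ->]]] := stepB_project_eq n0 (leqnn _) nL step sF' sG' E.
  exists (mulm (lvl n.+1) k K); split=> //.
  by apply: supp_mulm sk sK => i u j; apply: Sl_comp.
move=> Z hZ; apply: inv => F' G' sF' sG' E.
have [k [K [sk sK B2E]]] := stepB_project_eq n0 (leqnn _) nL step sF' sG' E.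
rewrite mulmA in B2E; have [|K' [sK' ->]] := hZ _ _ _ sK B2E.
  by apply: supp_mulm sF' sk => i u j; apply: Sl_comp => //; apply: ltnW.
exists (mulm (lvl n.+1) k K'); rewrite mulmA; split=> //.
by apply: supp_mulm sk sK' => i u j; apply: Sl_comp.
Qed.

End Errors.

(** * States of the algorithm *)

Section States.
Variable R : realType.
Variable beta : seq pattern.
Hypothesis chain : chainable_arch beta.
Local Notation L := (size beta).
Local Notation lvl := (lvl beta).
Local Notation Sl := (Sl beta).
Local Notation item := (item R).
Local Notation item0 := (item0 R).
Local Notation colo := (@colo R beta).
Local Notation rowo := (@rowo R beta).
Implicit Types (st l : seq item) (it : item) (M X Y : mx R).

(** The interval [[p+1, t]] of patterns leads from level [p] to level [t], so adjacent items share a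
    level. *)
Fixpoint wf p st q : Prop :=
  if st is it :: st' then
    [/\ it.1.1 = p.+1, (p < it.1.2)%N, supp (Sl p it.1.2) it.2 & wf it.1.2 st' q]
  else p = q.

Definition idm : mx R := fun i j => (i == j)%:R.
(** The trailing identity, unlike [prodl], allows an empty side of the split factor; it is neutral
    only on supported matrices. *)
Definition pl st : mx R := foldr (fun it M => mulm (lvl it.1.2) it.2 M) idm st.
Definition colo_item it := colo it.1.1.-1 it.1.2 it.2.
Definition rowo_item it := rowo it.1.1.-1 it.1.2 it.2.

Lemma wf_size p st q : wf p st q -> (p + size st <= q)%N.
Proof.
elim: st p => [|it st IH] p /=; first by move->; rewrite addn0.
by case=> _ h _ /IH h2; apply: leq_trans h2; rewrite addnS -addSn leq_add2r.
Qed.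

Lemma wf_cat p l1 l2 q : wf p (l1 ++ l2) q <-> exists r, wf p l1 r /\ wf r l2 q.
Proof.
elim: l1 p => [|it l1 IH] p /=; first by split=> [h|[r [<-]]] //; exists p.
split=> [[h1 h2 h3 /IH[r [h4 h5]]]|[r [[h1 h2 h3 h4] h5]]].
  by exists r; split.
by split=> //; apply/IH; exists r.
Qed.

Lemma mulm_idr p q X : supp (Sl p q) X -> mulm (lvl q) X idm = X.
Proof.
move=> sX; apply: mxext => i j; rewrite /mulm /idm.
have [jq|jq] := ltnP j (lvl q).
  rewrite (bigD1 (Ordinal jq)) //= eqxx mulr1 big1 ?addr0 // => u hu.
  have /negbTE -> : u != j :> nat by apply: contra hu => /eqP h; apply/eqP/val_inj.
  by rewrite mulr0.
rewrite sX; last by apply: contraL jq => /Sl_bound/andP[_]; rewrite -ltnNge.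
rewrite big1 // => u _; rewrite (negbTE (_ : u != j :> nat)) ?mulr0 //.
by rewrite neq_ltn (leq_trans (ltn_ord u) jq).
Qed.

Lemma mulm_idl p q X : supp (Sl p q) X -> mulm (lvl p) idm X = X.
Proof.
move=> sX; apply: mxext => i j; rewrite /mulm /idm.
have [ip|ip] := ltnP i (lvl p).
  rewrite (bigD1 (Ordinal ip)) //= eqxx mul1r big1 ?addr0 // => u hu.
  have /negbTE -> : i != u :> nat by apply: contra hu => /eqP h; apply/eqP/val_inj.
  by rewrite mul0r.
rewrite sX; last by apply: contraL ip => /Sl_bound/andP[h _]; rewrite -ltnNge.
rewrite big1 // => u _; rewrite (negbTE (_ : i != u :> nat)) ?mul0r //.
by rewrite neq_ltn (leq_trans (ltn_ord u) ip) orbT.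
Qed.

Lemma supp_pl p st q : (q <= L)%N -> (0 < size st)%N -> wf p st q ->
  supp (Sl p q) (pl st).
Proof.
move=> qL; elim: st p => // it st IH p _ /= [h1 h2 h3 h4].
case: st h4 IH => [|it' st] h4 IH.
  by rewrite /= (mulm_idr h3) -(h4 : it.1.2 = q).
have {}IH := IH _ isT h4.
have hq : (it.1.2 < q)%N by apply: leq_trans (wf_size h4); rewrite addnS ltnS leq_addr.
by apply: supp_mulm h3 IH => i u j; apply: Sl_comp.
Qed.

Lemma pl_cat p l1 r l2 q : (q <= L)%N -> (0 < size l2)%N ->
  wf p l1 r -> wf r l2 q -> pl (l1 ++ l2) = mulm (lvl r) (pl l1) (pl l2).
Proof.
move=> qL s2 + w2; elim: l1 p => [|it l1 IH] p /=.
  by move=> _; rewrite (mulm_idl (supp_pl qL s2 w2)).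
by case=> _ _ _ /IH ->; rewrite mulmA.
Qed.

Lemma opt_lift_lefts q l p s t M X Y : (p < s)%N -> (s < t)%N -> (t <= L)%N ->
  wf q l p -> (forall k, (k < size l)%N -> colo_item (nth item0 l k)) ->
  supp (Sl p t) M -> opt (lvl p) (lvl s) (lvl t) (Sl p s) (Sl s t) M X Y ->
  supp (Sl q t) (mulm (lvl p) (pl l) M) /\
  opt (lvl q) (lvl s) (lvl t) (Sl q s) (Sl s t)
    (mulm (lvl p) (pl l) M) (mulm (lvl p) (pl l) X) Y.
Proof.
move=> ps st tL + + sM o; elim: l q => [|it l IH] q /=.
  by move=> -> _; case: (o) => sX _ _; rewrite (mulm_idl sM) (mulm_idl sX).
case=> h1 h2 h3 wl hc; have [|sM' o'] := IH _ wl.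
  by move=> k kl; apply: (hc k.+1).
have hp : (it.1.2 <= p)%N by apply: leq_trans (wf_size wl); apply: leq_addr.
have hs := leq_ltn_trans hp ps.
have := hc 0%N isT; rewrite /colo_item /= h1 /= => co.
rewrite -!mulmA; split; last exact: opt_lift_left o'.
by apply: supp_mulm h3 sM' => i u j; apply: Sl_comp => //; apply: ltn_trans st.
Qed.

Lemma opt_lift_rights p s t l q M X Y : (p < s)%N -> (s < t)%N -> (q <= L)%N ->
  wf t l q -> (forall k, (k < size l)%N -> rowo_item (nth item0 l k)) ->
  supp (Sl p t) M -> opt (lvl p) (lvl s) (lvl t) (Sl p s) (Sl s t) M X Y ->
  opt (lvl p) (lvl s) (lvl q) (Sl p s) (Sl s q)
    (mulm (lvl t) M (pl l)) X (mulm (lvl t) Y (pl l)).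
Proof.
move=> ps st qL; elim: l t M Y st => [|it l IH] t M Y st /=.
  by move=> <- _ sM o; case: (o) => _ sY _; rewrite (mulm_idr sM) (mulm_idr sY).
case=> h1 h2 h3 wl hc sM o.
have hq : (it.1.2 <= q)%N by apply: leq_trans (wf_size wl); apply: leq_addr.
have := hc 0%N isT; rewrite /rowo_item /= h1 /= => ro.
rewrite !mulmA; apply: IH => //.
- exact: ltn_trans h2.
- by move=> k kl; apply: (hc k.+1).
- apply: supp_mulm sM h3 => i u j; apply: Sl_comp => //.
    exact: ltn_trans st.
  exact: leq_trans qL.
by apply: opt_lift_right => //; apply: leq_trans qL.
Qed.

Lemma split_pair (T : Type) (x0 : T) (s : seq T) k : (k.+1 < size s)%N ->
  s = take k s ++ nth x0 s k :: nth x0 s k.+1 :: drop k.+2 s.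
Proof.
by move=> ks; rewrite -!drop_nth ?cat_take_drop // ltnW.
Qed.

Lemma set_pair st k x y : (k.+1 < size st)%N ->
  set_nth item0 (set_nth item0 st k x) k.+1 y = take k st ++ x :: y :: drop k.+2 st.
Proof.
elim: k st => [|k IH] [|a [|b st]] //=; first by rewrite drop0.
by move=> ks; rewrite -IH.
Qed.

Lemma wf_pair p l1 I1 I2 l2 q : wf p (l1 ++ I1 :: I2 :: l2) q -> (q <= L)%N ->
  exists r, [/\ I1.1.1 = r.+1, I2.1.1 = I1.1.2.+1, supp (Sl r I1.1.2) I1.2,
    supp (Sl I1.1.2 I2.1.2) I2.2 & [/\ (r < I1.1.2)%N, (I1.1.2 < I2.1.2)%N &
      (I2.1.2 <= L)%N]] /\
  forall X Y, supp (Sl r I1.1.2) X -> supp (Sl I1.1.2 I2.1.2) Y ->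
    mulm (lvl I1.1.2) X Y = mulm (lvl I1.1.2) I1.2 I2.2 ->
    wf p (l1 ++ (I1.1, X) :: (I2.1, Y) :: l2) q /\
    pl (l1 ++ (I1.1, X) :: (I2.1, Y) :: l2) = pl (l1 ++ I1 :: I2 :: l2).
Proof.
move=> /wf_cat [r [w1 /= [h1 h2 h3 [h4 h5 h6 w2]]]] qL; exists r; split.
  split=> //; split=> //; apply: leq_trans qL.
  by apply: leq_trans (wf_size w2); apply: leq_addr.
move=> X Y sX sY e; split; first by apply/wf_cat; exists r.
by rewrite /pl !foldr_cat /= !mulmA e.
Qed.

Lemma wf_ortho st k X' Y' : wf 0 st L -> (k.+1 < size st)%N ->
  let I1 := nth item0 st k in let I2 := nth item0 st k.+1 in
  let st' := set_nth item0 (set_nth item0 st k (I1.1, X')) k.+1 (I2.1, Y') in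
  (OrthoCol (ipat beta I1) (ipat beta I2) I1.2 I2.2 X' Y' ->
    [/\ wf 0 st' L, pl st' = pl st & colo_item (nth item0 st' k)]) /\
  (OrthoRow (ipat beta I1) (ipat beta I2) I1.2 I2.2 X' Y' ->
    [/\ wf 0 st' L, pl st' = pl st & rowo_item (nth item0 st' k.+1)]).
Proof.
move=> w ks I1 I2; rewrite set_pair //.
have stE := split_pair item0 ks; rewrite -/I1 -/I2 in stE.
rewrite /=; have s1 : size (take k st) = k by rewrite size_takel // ltnW // ltnW.
have w' : wf 0 (take k st ++ I1 :: I2 :: drop k.+2 st) L by rewrite -stE.
have [r [[h1 h2 h3 h4 [h5 h6 h7]] h8]] := wf_pair w' (leqnn L); rewrite -stE in h8.
rewrite /OrthoCol /OrthoRow /ipat h1 h2.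
have i1L : (I1.1.2 <= L)%N := ltnW (leq_trans h6 h7).
have [_ _ _ e1 e2] := pint_spec chain h5 i1L.
have [_ _ _ _ e3] := pint_spec chain h6 h7.
rewrite !Sb_pint // e1 e2 e3 /=.
split=> [/(ortho_col_spec chain h5 h6 h7 h3 h4)|/(ortho_row_spec chain h5 h6 h7 h3 h4)]
  [g1 g2 g3 g4].
  have [g5 g6] := h8 _ _ g1 g2 g3; split=> //.
  by rewrite nth_cat s1 ltnn subnn /colo_item /= h1.
have [g5 g6] := h8 _ _ g1 g2 g3; split=> //.
by rewrite nth_cat s1 ltnNge leqnSn /= subSn // subnn /rowo_item /= h2.
Qed.

Lemma nth_setN st n k x : k != n -> nth item0 (set_nth item0 st n x) k = nth item0 st k.
Proof. by move=> /negbTE kn; rewrite nth_set_nth /= kn. Qed.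

Lemma fst_set st k X : (k < size st)%N ->
  map fst (set_nth item0 st k ((nth item0 st k).1, X)) = map fst st.
Proof. by elim: st k => [|a st IH] [|k] //= ks; rewrite IH. Qed.

Lemma size_set st k x : (k < size st)%N -> size (set_nth item0 st k x) = size st.
Proof. by move=> h; rewrite size_set_nth; apply/maxn_idPr. Qed.

Lemma fst_set_pair st k X Y : (k.+1 < size st)%N ->
  map fst (set_nth item0 (set_nth item0 st k ((nth item0 st k).1, X)) k.+1
    ((nth item0 st k.+1).1, Y)) = map fst st.
Proof.
move=> ks; have := @fst_set (set_nth item0 st k ((nth item0 st k).1, X)) k.+1 Y.
rewrite size_set ?(ltnW ks) // nth_set_nth /= eqn_leq ltnn /= => -> //.
by rewrite fst_set // ltnW.
Qed.

(** Step [n+1] changes only positions [n] and [n+1], so the orthonormality gained at earlier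
    positions is kept while the triangular factors move right. *)
Lemma col_pass st st' n : wf 0 st L -> (n < size st)%N ->
  iter_rel (iota 1 n) (col_step beta) st st' ->
  [/\ wf 0 st' L, pl st' = pl st, map fst st' = map fst st &
    forall k, (k < n)%N -> colo_item (nth item0 st' k)].
Proof.
move=> w; elim: n st' => [|n IH] st' ns; first by move=> /= <-.
rewrite iota_rcons add1n => /iter_rel_rcons [st1 [/IH h hs]].
have {h}[w1 p1 f1 c1] := h (ltnW ns).
have ns1 : (n.+1 < size st1)%N by rewrite -(size_map fst) f1 size_map.
case: hs => X' [Y' /= [ho ->]].
have [/(_ ho) [w2 p2 c2] _] := wf_ortho X' Y' w1 ns1.
split=> //; [by rewrite p2|by rewrite fst_set_pair|].
move=> k; rewrite ltnS leq_eqVlt => /orP[/eqP->//|kn].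
rewrite !nth_setN ?neq_ltn ?kn ?(ltn_trans kn (ltnSn n)) //; exact: c1.
Qed.

(** The sweep to the left ends at position [j-1], so the columns already orthonormal before that
    position are untouched. *)
Lemma row_pass st st' j m : wf 0 st L -> (0 < j)%N -> (j + m = size st)%N ->
  iter_rel (rev (iota j.+1 m)) (row_step beta) st st' ->
  [/\ wf 0 st' L, pl st' = pl st, map fst st' = map fst st,
    (forall k, (k < j.-1)%N -> nth item0 st' k = nth item0 st k) &
    forall k, (j <= k < size st)%N -> rowo_item (nth item0 st' k)].
Proof.
move=> w; elim: m j st' => [|m IH] j st' j0.
  rewrite addn0 => <- /= <-; split=> // k.
  by rewrite leqNgt => /andP[/negbTE->].
rewrite addnS -addSn => jm; rewrite /= rev_cons => /iter_rel_rcons [st1 [/IH h hs]].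
have {h}[w1 p1 f1 e1 c1] := h isT jm.
case: j j0 jm hs e1 c1 => // j _ jm hs e1 c1.
have ns1 : (j.+1 < size st1)%N.
  by rewrite -(size_map fst) f1 size_map -jm leq_addr.
case: hs => X' [Y' /= [ho ->]].
have [_ /(_ ho) [w2 p2 c2]] := wf_ortho X' Y' w1 ns1.
split=> //; [by rewrite p2|by rewrite fst_set_pair| |].
  move=> k kj; rewrite !nth_setN ?neq_ltn ?kj ?(ltn_trans kj (ltnSn j)) //.
  by apply: e1; apply: ltnW.
move=> k /andP[]; rewrite leq_eqVlt => /orP[/eqP<-//|jk] ks.
rewrite !nth_setN ?neq_ltn ?jk ?(ltn_trans (ltnSn j) jk) ?orbT //.
by apply: c1; rewrite jk.
Qed.

(** The local optimum is lifted through the orthonormal factors on both sides. The last conclusion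
    records right ends of intervals, for [run_inv]. *)
Lemma split_stepB st j s st' : wf 0 st L -> (0 < j <= size st)%N ->
  let it := nth item0 st j.-1 in
  (it.1.1 <= s < it.1.2)%N ->
  (forall k, (k < j.-1)%N -> colo_item (nth item0 st k)) ->
  (forall k, (j <= k < size st)%N -> rowo_item (nth item0 st k)) ->
  split_step beta s j st st' ->
  [/\ wf 0 st' L, stepB beta s (pl st) (pl st'), size st' = (size st).+1 &
    forall k, (k < size st')%N -> (nth item0 st' k).1.2 = s \/
      exists k', (k' < size st)%N /\ (nth item0 st' k).1.2 = (nth item0 st k').1.2].
Proof.
case: j => // j w /= js; set it := nth item0 st j => sit co ro.
have stE : st = take j st ++ it :: drop j.+1 st by rewrite -drop_nth ?cat_take_drop.
case=> X1 [X2 [tf ->]]; move: tf; rewrite /TwoFactor -/it.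
have s1 : size (take j st) = j by rewrite size_takel // ltnW.
have := w; rewrite {1}stE => /wf_cat [p [w1 /= [h1 h2 h3 w2]]].
case/andP: sit; rewrite h1 => ps si.
have tL : (it.1.2 <= L)%N by apply: leq_trans (wf_size w2); apply: leq_addr.
have sL := ltnW (leq_trans si tL).
have [_ _ _ e1 e2] := pint_spec chain ps sL.
have [_ _ _ _ e3] := pint_spec chain si tL.
rewrite !Sb_pint // e1 e2 e3 => /(twofactor_opt chain ps si tL) o.
have mE : maskm (Sl p it.1.2) it.2 = it.2.
  by apply: mxext => a b; rewrite /maskm; case: ifP => // /negbT /h3.
rewrite mE in o; case: (o) => sX1 sX2 _.
have co' k : (k < size (take j st))%N -> colo_item (nth item0 (take j st) k).
  by rewrite s1 => kj; rewrite nth_take //; apply: co.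
have [sM o1] := opt_lift_lefts ps si tL w1 co' h3 o.
have s0 : (0 < s)%N by apply: leq_ltn_trans ps.
have o2 : opt (lvl 0) (lvl s) (lvl L) (Sl 0 s) (Sl s L)
    (mulm (lvl it.1.2) (mulm (lvl p) (pl (take j st)) it.2) (pl (drop j.+1 st)))
    (mulm (lvl p) (pl (take j st)) X1) (mulm (lvl it.1.2) X2 (pl (drop j.+1 st))).
  apply: opt_lift_rights o1 => // k; rewrite size_drop => kd; rewrite nth_drop.
  by apply: ro; rewrite leq_addr /= -ltn_subRL.
have w' : wf 0 (take j st ++ [:: (p.+1, s, X1), (s.+1, it.1.2, X2) & drop j.+1 st]) L.
  by apply/wf_cat; exists p.
split.
- exact: w'.
- exists (mulm (lvl p) (pl (take j st)) X1), (mulm (lvl it.1.2) X2 (pl (drop j.+1 st))).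
  split; last by rewrite (pl_cat (leqnn L) _ w1 (q := L)) //= mulmA.
  suff -> : pl st = mulm (lvl it.1.2) (mulm (lvl p) (pl (take j st)) it.2)
    (pl (drop j.+1 st)) by [].
  by rewrite {1}stE (pl_cat (leqnn L) _ w1 (q := L)) //= mulmA.
- rewrite size_cat /= size_drop s1; clear -js; lia.
move=> k; rewrite size_cat /= size_drop s1 => kk.
rewrite nth_cat s1; case: ltnP => kj.
  by right; exists k; rewrite nth_take //; split=> //; apply: ltn_trans js.
case E: (k - j)%N => [|[|i]] /=; first by left.
  by right; exists j.
right; exists k.-1; rewrite nth_drop; have -> : (j.+1 + i = k.-1)%N by clear -E; lia.
by split=> //; clear -E kk; lia.
Qed.

End States.

(** * Runs of the algorithm *)

Section Run.
Variable R : realType.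
Variable beta : seq pattern.
Hypothesis chain : chainable_arch beta.
Local Notation L := (size beta).
Local Notation lvl := (lvl beta).
Local Notation Sl := (Sl beta).
Local Notation item0 := (item0 R).
Local Notation pl := (@pl R beta).
Local Notation wf := (@wf R beta).
Implicit Types (A : mx R) (st : seq (item R)).

Section Sigma.
Variable sigma : seq nat.
Hypothesis sigmaP : perm_eq sigma (iota 1 L.-1).

Let sigma_mem s : (s \in sigma) = (0 < s < L)%N.
Proof.
rewrite (perm_mem sigmaP) mem_iota add1n; case: (L) => [|n] //=.
by case: s.
Qed.
Let sigma_size : size sigma = L.-1.
Proof. by rewrite (perm_size sigmaP) size_iota. Qed.
Let sigma_uniq : uniq sigma.
Proof. by rewrite (perm_uniq sigmaP) iota_uniq. Qed.

(** A new split point differs from [L] and from all previous ones, so it is not the right end of its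
    interval and both halves are nonempty. *)
Definition run_inv n st := [/\ wf 0 st L, size st = n.+1 &
  forall k, (k < size st)%N ->
    (nth item0 st k).1.2 = L \/ (nth item0 st k).1.2 \in take n sigma].

Lemma bf_step_inv n st st' : (n < L.-1)%N -> run_inv n st ->
  bf_step beta sigma n.+1 st st' ->
  run_inv n.+1 st' /\ stepB beta (nth 0%N sigma n) (pl st) (pl st').
Proof.
move=> nL [w sz ends] [j [/andP[j0 js] /=]]; set s := nth 0%N sigma n => sit.
case=> st1 [st2 [h1 h2 h3]].
have sS : s \in sigma by rewrite mem_nth // sigma_size.
have sT : s \notin take n sigma.
  apply/negP => /(nthP 0%N) [k]; rewrite size_takel ?sigma_size ?(ltnW nL) // => kn.
  rewrite nth_take // => /eqP; rewrite nth_uniq ?sigma_size // ?(ltn_trans kn) //.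
  by rewrite ltn_eqF.
have jS : (j.-1 < size st)%N by case: (j) j0 js.
have [w1 p1 f1 c1] := col_pass chain w jS h1.
have sz1 : size st1 = size st by rewrite -(size_map fst) f1 size_map.
have jm : (j + (n.+1 - j) = size st1)%N by rewrite sz1 sz subnKC // -sz.
have [w2 p2 f2 e2 c2] := row_pass chain w1 j0 jm h2.
have sz2 : size st2 = size st by rewrite -(size_map fst) f2 size_map.
have fE k : (k < size st)%N -> (nth item0 st2 k).1 = (nth item0 st k).1.
  move=> ks; rewrite -!(nth_map _ (0%N, 0%N) fst) ?sz2 // f2 f1 //.
have sit2 : ((nth item0 st2 j.-1).1.1 <= s < (nth item0 st2 j.-1).1.2)%N.
  rewrite fE //; case/andP: sit => -> /=; rewrite leq_eqVlt => /orP[/eqP sE|//].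
  move: (ends _ jS) sS; rewrite -sE sigma_mem => -[->|h]; first by rewrite ltnn andbF.
  by rewrite h in sT.
have j2 : (0 < j <= size st2)%N by rewrite j0 sz2.
have co2 k : (k < j.-1)%N -> colo_item beta (nth item0 st2 k).
  by move=> kj; rewrite e2 //; apply: c1.
have ro2 k : (j <= k < size st2)%N -> rowo_item beta (nth item0 st2 k).
  by rewrite sz2 -sz1; apply: c2.
have [w3 st3 sz3 e3] := split_stepB chain w2 j2 sit2 co2 ro2 h3.
split; last by move: st3; rewrite p2 p1.
split=> //; first by rewrite sz3 sz2 sz.
have tk : take n.+1 sigma = rcons (take n sigma) s by rewrite -take_nth ?sigma_size.
move=> k /e3 [->|[k' [ks ->]]].
  by right; rewrite tk mem_rcons mem_head.
rewrite sz2 in ks; rewrite fE //; case: (ends _ ks) => [->|h]; first by left.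
by right; rewrite tk mem_rcons in_cons h orbT.
Qed.

(** The input [A] need not have the support required by [wf]; the first [TwoFactor] reads it only
    inside that support. *)
Lemma bf_step_mask A st : (1 < L)%N -> bf_step beta sigma 1 [:: ((1%N, L), A)] st ->
  bf_step beta sigma 1 [:: ((1%N, L), maskm (Sl 0 L) A)] st.
Proof.
move=> L1 [j [/= hj hs [st1 [st2 [h1 h2 h3]]]]]; exists j.
(* With a single interval both QR sweeps are empty. *)
have {}hj : j = 1%N by case: j hj {hs h1 h2 h3} => [|[|j]].
rewrite {}hj /= in h1 h2 h3 hs *; split=> //.
exists [:: ((1%N, L), maskm (Sl 0 L) A)], [:: ((1%N, L), maskm (Sl 0 L) A)]; split=> //.
rewrite -{}h2 -{}h1 in h3; case: h3 => X1 [X2 [/= tf ->]]; exists X1, X2; split=> //=.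
have : nth 0%N sigma 0 \in sigma by rewrite mem_nth // sigma_size; case: (L) L1.
rewrite sigma_mem => /andP[s0 sL]; move: tf s0 sL; set s := nth _ _ _ => + s0 sL.
have [_ _ _ e1 e2] := pint_spec chain s0 (ltnW sL).
have [_ _ _ _ e3] := pint_spec chain sL (leqnn L).
rewrite /TwoFactor !Sb_pint // ?(ltnW sL) // e1 e2 e3 => -[t1 t2 t3]; split=> // t tl H K.
have := t3 t tl H K; rewrite /blockres.
suff E (F G : mx R) : \sum_(i < lvl 0 | inR (lvl 0) (lvl L) (Sl 0 s) (Sl s L) t i)
     \sum_(j < lvl L | inC (lvl 0) (lvl L) (Sl 0 s) (Sl s L) t j)
        sqn (maskm (Sl 0 L) A i j -
          \sum_(s0 < lvl s | simc (lvl 0) (lvl L) (Sl 0 s) (Sl s L) s0 t)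
                        F i s0 * G s0 j) =
   \sum_(i < lvl 0 | inR (lvl 0) (lvl L) (Sl 0 s) (Sl s L) t i)
     \sum_(j < lvl L | inC (lvl 0) (lvl L) (Sl 0 s) (Sl s L) t j)
        sqn (A i j - \sum_(s0 < lvl s | simc (lvl 0) (lvl L) (Sl 0 s) (Sl s L) s0 t)
                        F i s0 * G s0 j) by rewrite !E.
apply: eq_bigr => i; rewrite inR_Sl // => S1; apply: eq_bigr => j'; rewrite inC_Sl // => S2.
by rewrite /maskm (Sl_comp chain s0 sL (leqnn L) S1 S2).
Qed.

Lemma nr_run A st : (1 < L)%N ->
  iter_rel (iota 1 L.-1) (bf_step beta sigma) [:: ((1%N, L), A)] st ->
  [/\ wf 0 st L, size st = L & iter_rel sigma (stepB beta) (maskm (Sl 0 L) A) (pl st)].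
Proof.
move=> L1 h; pose B := maskm (Sl 0 L) A.
have L0 : (0 < L)%N by apply: ltnW.
have sB : supp (Sl 0 L) B by move=> i j /negbTE e; rewrite /B /maskm e.
have {}h : iter_rel (iota 1 L.-1) (bf_step beta sigma) [:: ((1%N, L), B)] st.
  move: L1 h; case E: (L) => [|[|n]] //= L1 [st1 [h1 h2]]; exists st1; split=> //.
  by rewrite -E in h1 *; apply: bf_step_mask => //; rewrite E.
suff gen n st' : (n <= L.-1)%N ->
    iter_rel (iota 1 n) (bf_step beta sigma) [:: ((1%N, L), B)] st' ->
    run_inv n st' /\ iter_rel (take n sigma) (stepB beta) B (pl st').
  have [[w sz _] r] := gen _ _ (leqnn _) h; split=> //; first by rewrite sz prednK.
  by move: r; rewrite take_oversize ?sigma_size.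
elim: n st' => [|n IH] st' nL.
  move=> /= <-; rewrite take0 /=; split; last by rewrite (mulm_idr sB).
  by split=> //= -[|//] _; left.
rewrite iota_rcons add1n => /iter_rel_rcons [st1 [/IH h1 h2]].
have [i1 r1] := h1 (ltnW nL); have [i2 r2] := bf_step_inv nL i1 h2.
split=> //; rewrite (take_nth 0%N) ?sigma_size //; apply/iter_rel_rcons.
by exists (pl st1).
Qed.

End Sigma.

(** As many items as patterns to cover: by counting, every interval is a single pattern. *)
Lemma prodl_pl st p : (0 < size st)%N -> (p + size st <= L)%N ->
  wf p st (p + size st) -> prodl (zip (drop p beta) (map snd st)) = pl st.
Proof.
elim: st p => // it st IH p _ pL /= [h1 h2 h3 h4].
have pl1 : (p < L)%N by apply: leq_trans pL; rewrite addnS ltnS leq_addr.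
have e : it.1.2 = p.+1.
  apply/eqP; rewrite eqn_leq h2 andbT -(leq_add2r (size st)) addSnnS.
  exact: (wf_size h4).
rewrite (drop_nth pat0) //=; rewrite e in h3 h4 *; case: st IH pL h4 => [|it' st] IH pL h4.
  by rewrite /= (mulm_idr h3); case: (drop _ _).
rewrite -(IH p.+1) //; last 2 first.
- by rewrite addSnnS.
- by move: h4; rewrite addnS addSn.
have : (p.+1 < L)%N by apply: leq_trans pL; rewrite /= !addnS !ltnS leq_addr.
by move=> p1L; rewrite (drop_nth pat0 p1L) /=.
Qed.

(** Presents a competitor as a state, so that its product can be cut at any boundary. *)
Lemma factors_state Xs : in_Sigma beta Xs ->
  exists st, [/\ wf 0 st L, size st = L & map snd st = Xs].
Proof.
case=> sz hX; pose f k : item R := ((k.+1, k.+1), nth (mx0 R) Xs k).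
exists [seq f k | k <- iota 0 L]; split; last 2 first.
- by rewrite size_map size_iota.
- by rewrite -map_comp -sz -[RHS](mkseq_nth (mx0 R)).
suff gen m n : (m + n <= L)%N -> wf m [seq f k | k <- iota m n] (m + n).
  by rewrite -[L in wf _ _ L]add0n; apply: gen.
elim: n m => [|n IH] m h /=; first by rewrite addn0.
have mL : (m < L)%N by apply: leq_trans h; rewrite addnS ltnS leq_addr.
split=> //; last by rewrite -addSnnS; apply: IH; rewrite addSnnS.
rewrite -Sb_pint //; have -> : pint beta m.+1 m.+1 = nth pat0 beta m.
  by rewrite /pint subnn.
exact: hX.
Qed.

(** The entries of [A] off the support cost the same for every product. At depth one this already
    gives optimality of the mask. *)
Lemma n2_mask A B : supp (Sl 0 L) B -> n2 (lvl 0) (lvl L) (subm A B) =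
  n2 (lvl 0) (lvl L) (subm A (maskm (Sl 0 L) A)) +
  n2 (lvl 0) (lvl L) (subm (maskm (Sl 0 L) A) B).
Proof.
move=> sB; rewrite /n2 -big_split; apply: eq_bigr => i _ /=.
rewrite -big_split; apply: eq_bigr => j _ /=; rewrite /subm /maskm.
case: ifP => [_|/negbT /sB ->]; first by rewrite subrr sqn0 add0r.
by rewrite !subr0 sqn0 addr0.
Qed.

Lemma butterfly_nr_error A sigma Xs Ws : perm_eq sigma (iota 1 L.-1) ->
  butterfly_nr beta A sigma Xs -> in_Sigma beta Ws ->
  n2 (lvl 0) (lvl L) (subm A (prodl (zip beta Xs))) <= (maxn L 2).-1%:R ^+ 2 *
    n2 (lvl 0) (lvl L) (subm A (prodl (zip beta Ws))) /\
  (sigma = iota 1 L.-1 ->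
   n2 (lvl 0) (lvl L) (subm A (prodl (zip beta Xs))) <= (maxn L 2).-1%:R *
    n2 (lvl 0) (lvl L) (subm A (prodl (zip beta Ws)))).
Proof.
move=> sP bf hW; have [wst [wW sW eW]] := factors_state hW.
have L0 : (0 < L)%N by case: chain => -[]; case: (beta).
have -> : prodl (zip beta Ws) = pl wst.
  by rewrite -eW -[beta in zip beta]drop0 prodl_pl ?add0n ?sW.
have sZ : supp (Sl 0 L) (pl wst) by apply: supp_pl => //; rewrite sW.
move: bf; rewrite /butterfly_nr; case: eqP => [L1 ->|L1].
  have sS : Sb (pi_ beta 1) = Sl 0 L by rewrite L1 -Sb_pint // L1.
  suff h : n2 (lvl 0) (lvl L) (subm A (prodl (zip beta
      [:: fun i j => A i j * (Sb (pi_ beta 1) i j)%:R]))) <=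
      n2 (lvl 0) (lvl L) (subm A (pl wst)).
    by rewrite L1 expr1n mul1r; move: h; rewrite L1.
  have -> : prodl (zip beta [:: fun i j => A i j * (Sb (pi_ beta 1) i j)%:R]) =
      maskm (Sl 0 L) A.
    rewrite sS; case: (beta) L1 => [|b [|]] //= _; apply: mxext => i j.
    by rewrite /maskm; case: ifP; rewrite ?mulr1 ?mulr0.
  by rewrite [X in _ <= X]n2_mask // lerDl n2_ge0.
have L2 : (1 < L)%N by move/eqP: L1 L0; case: (L) => [|[|]].
case=> st [/(nr_run sP L2) [w sz run] ->].
have -> : prodl (zip beta (map snd st)) = pl st.
  by rewrite -[beta in zip beta]drop0 prodl_pl ?add0n ?sz.
have sB : supp (Sl 0 L) (pl st) by apply: supp_pl => //; rewrite sz.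
rewrite (n2_mask A sB) (n2_mask A sZ).
set o := n2 _ _ (subm A _); set e2 := n2 _ _ (subm _ (pl wst)).
have e0 : 0 <= e2 by apply: n2_ge0.
have o0 : 0 <= o by apply: n2_ge0.
(* Cutting the competitor at [s] makes it a product of two factors, at the same distance [e2] for
   every boundary. *)
have hA s : (0 < s < L)%N -> approx2 beta e2 s (maskm (Sl 0 L) A).
  move=> /andP[s0 sL]; have := wW.
  rewrite -{1}(cat_take_drop s wst) => /wf_cat [r [w1 w2]].
  have rE : r = s.
    have := wf_size w1; have := wf_size w2; rewrite size_drop size_takel ?sW ?(ltnW sL) //.
    by clear -sL; lia.
  rewrite {}rE in w1 w2; have d0 : (0 < size (drop s wst))%N.
    by rewrite size_drop sW subn_gt0.
  exists (pl (take s wst)), (pl (drop s wst)); split.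
  - by apply: supp_pl w1; rewrite ?(ltnW sL) // size_takel ?sW // ltnW.
  - exact: supp_pl w2.
  by rewrite -(pl_cat chain (leqnn L) d0 w1 w2) cat_take_drop.
have -> : (maxn L 2).-1 = L.-1 by rewrite (maxn_idPl L2).
(* Since [c >= 1], the common cost [o] off the support is absorbed by the constant. *)
set c : R := L.-1%:R; have c1 : 1 <= c by rewrite ler1n; case: (L) L2 => [|[]].
split=> [|sI].
  have sL s : s \in sigma -> (0 < s < L)%N.
    by rewrite (perm_mem sP) mem_iota add1n prednK.
  have [_] := run_error chain e0 sL hA run.
  rewrite (perm_size sP) size_iota -/c => h; rewrite mulrDr; apply: lerD => //.
  by rewrite ler_peMl // exprn_ege1.
have Lp : (L.-1 < L)%N by rewrite prednK.
rewrite sI in run; have [h _] := run_error_id chain e0 Lp hA run.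
by rewrite mulrDr; apply: lerD => //; rewrite ler_peMl.
Qed.

End Run.

(** * Redundant architectures *)

Section Merging.
Variable R : realType.

(** The product pattern keeps [a] and the value [b d] of its first member, so its [r] with the left
    neighbour is unchanged. *)
Lemma chainable_star_r p0 p1 p2 : pattern_pos p1 -> chainable p0 p1 ->
  chainable p1 p2 -> chainable p0 (star p1 p2).
Proof.
case: p1 => a1 b1 c1 d1 pos1 /and5P[/= h1 h2 h3 h4 h5] /and5P[/= _ _ _ _ g5].
have e : (b1 * d1 %/ pd p2 * pd p2 = b1 * d1)%N by rewrite divnK // dvdn_mull.
by apply/and5P; rewrite /= e; split=> //; apply: dvdn_trans h5.
Qed.

Lemma chainable_star_l p1 p2 p3 : chainable p1 p2 ->
  chainable p2 p3 -> chainable (star p1 p2) p3.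
Proof.
case: p2 => a2 b2 c2 d2 /and5P[/= _ _ _ g4 _] /and5P[/= h1 h2 h3 h4 h5].
have e : (pa p1 * (a2 * c2 %/ pa p1) = a2 * c2)%N by rewrite mulnC divnK // dvdn_mulr.
by apply/and5P; rewrite /= e; split=> //; apply: dvdn_trans h4.
Qed.

Lemma Sb_star p1 p2 i u j : pattern_pos p1 -> pattern_pos p2 -> chainable p1 p2 ->
  pcols p1 = prows p2 -> Sb p1 i u -> Sb p2 u j -> Sb (star p1 p2) i j.
Proof.
move=> pos1 pos2 ch e.
(* The pair is an architecture of its own, with levels 0, 1, 2, to which [Sl_comp] applies. *)
have chain : chainable_arch [:: p1; p2].
  split; last by case=> [|k].
  by split=> //=; [rewrite pos1 pos2|case=> [|k]].
have := @Sl_comp _ chain 0 1 2 isT isT isT i u j.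
by rewrite -!(Sb_pint chain).
Qed.

Lemma prodl_star l1 p1 p2 l2 (xs1 : seq (mx R)) X Y xs2 : size l1 = size xs1 ->
  pcols (star p1 p2) = pcols p2 ->
  prodl (zip (l1 ++ p1 :: p2 :: l2) (xs1 ++ X :: Y :: xs2)) =
  prodl (zip (l1 ++ star p1 p2 :: l2) (xs1 ++ mulm (pcols p1) X Y :: xs2)).
Proof.
move=> sz e; rewrite !zip_cat //=.
elim: (zip l1 xs1) => [|[p M] l IH] /=.
  by case: (zip l2 xs2) => //= a l; rewrite e mulmA.
by case: l IH => [|b l] /= IH; rewrite IH.
Qed.

(** Multiplying the two merged factors turns a competitor of the old architecture into one of the
    new with the same product, so bounds against the new competitors transfer back. *)
Lemma merge_step_spec (x y : seq pattern * seq nat) : chainable_arch x.1 -> merge_step x y ->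
  [/\ chainable_arch y.1, size x.1 = (size y.1).+1, arch_rows y.1 = arch_rows x.1,
    arch_cols y.1 = arch_cols x.1 &
    forall Xs : seq (mx R), in_Sigma x.1 Xs -> exists Ys, in_Sigma y.1 Ys /\
      prodl (zip x.1 Xs) = prodl (zip y.1 Ys)].
Proof.
case: x y => beta bs [beta' bs'] /= ch [k [/= kb red [-> _]]].
set p1 := nth pat0 beta k; set p2 := nth pat0 beta k.+1.
set gamma := take k beta ++ star p1 p2 :: drop k.+2 beta.
have posn i : (i < size beta)%N -> pattern_pos (nth pat0 beta i).
  by move=> ib; apply: (pi_pos ch (k := i.+1)).
have pos1 : pattern_pos p1 by apply: posn; apply: ltnW.
have pos2 : pattern_pos p2 by apply: posn.
have ch12 : chainable p1 p2 by case: ch => _; apply.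
have e12 : pcols p1 = prows p2 by case: ch => -[_ _ h] _; apply: h.
have [spos sr sc] : [/\ pattern_pos (star p1 p2), prows (star p1 p2) = prows p1 &
    pcols (star p1 p2) = pcols p2].
  by have /and5P[_ _ _ h4 h5] := ch12; apply: star_spec.
have st : size (take k beta) = k by rewrite size_takel // ltnW // ltnW.
have sz : size beta = (size gamma).+1.
  by rewrite size_cat /= size_drop st; clear -kb; lia.
have nthg i : nth pat0 gamma i = if (i < k)%N then nth pat0 beta i
    else if i == k then star p1 p2 else nth pat0 beta i.+1.
  rewrite nth_cat st; case: ltnP => ik; first by rewrite nth_take.
  have [->|ne] := eqVneq i k; first by rewrite subnn.
  have ki : (k < i)%N by rewrite ltn_neqAle eq_sym ne.
  rewrite -(subnSK ki) /= nth_drop; congr nth; clear -ki; lia.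
(* For an arbitrary relation, to serve both the size condition and chainability. *)
have cons (r : pattern -> pattern -> Prop) : consec r beta ->
    (forall p, r p p1 -> r p (star p1 p2)) -> (forall p, r p2 p -> r (star p1 p2) p) ->
    consec r gamma.
  move=> cr h1 h2 i ig; have ib : (i.+2 < size beta)%N by rewrite sz.
  rewrite !nthg; case: (ltngtP i k) => ik.
  - case: (ltngtP i.+1 k) => ik'.
    + by apply: cr; apply: ltnW.
    + by rewrite ltnNge ik in ik'.
    by apply: h1; rewrite /p1 -ik'; apply: cr; apply: ltnW.
  - have -> : (i.+1 < k)%N = false by clear -ik; lia.
    have -> : (i.+1 == k) = false by clear -ik; lia.
    exact: cr.
  have -> : (i.+1 < k)%N = false by clear -ik; lia.
  have -> : (i.+1 == k) = false by clear -ik; lia.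
  by apply: h2; rewrite /p2 -ik; apply: cr.
have g0 : gamma <> [::] by rewrite /gamma; case: (take k beta).
have chg : chainable_arch gamma.
  have [[_ /all_nthP posb crc] cch] := ch; split; last first.
    apply: cons cch _ _ => p h; first exact: chainable_star_r.
    exact: chainable_star_l.
  split=> //; last by apply: cons crc _ _ => p; rewrite ?sr ?sc.
  apply/(all_nthP pat0) => i ig; rewrite nthg; case: ifP => _.
    by apply: posn; rewrite sz ltnS ltnW.
  by case: ifP => // _; apply: posn; rewrite sz ltnS.
split=> //.
- rewrite /arch_rows /pi_ /= nthg; case: ifP => // /negbT; rewrite lt0n negbK => /eqP k0.
  by rewrite k0 /= sr /p1 k0.
- rewrite /arch_cols /pi_ nthg sz /=.
  have -> : ((size gamma).-1 < k)%N = false by clear -kb sz; lia.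
  have [e|_] := eqVneq; first by rewrite sc /p2 -e prednK //; clear -kb sz; lia.
  by rewrite prednK //; clear -kb sz; lia.
move=> Xs [sX hX].
exists (take k Xs ++ mulm (pcols p1) (nth (mx0 R) Xs k) (nth (mx0 R) Xs k.+1) :: drop k.+2 Xs).
have stX : size (take k Xs) = k by rewrite size_takel // sX ltnW // ltnW.
split; last first.
  rewrite -prodl_star ?st ?stX // -split_pair ?sX //.
  by rewrite /p1 /p2 -split_pair.
split; first by rewrite !size_cat /= !size_drop st stX sX.
move=> i ig; rewrite nthg nth_cat stX; case: ltnP => ik.
  by rewrite nth_take //; apply: hX; rewrite sz ltnS ltnW.
have [->|ne] := eqVneq i k.
  rewrite subnn /=; apply: (@supp_mulm R _ (Sb p1) (Sb p2)).
  - by move=> a u b; apply: Sb_star.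
  - by apply: hX; apply: ltnW.
  exact: hX.
have ki : (k < i)%N by rewrite ltn_neqAle eq_sym ne.
rewrite -(subnSK ki) /= nth_drop; have -> : (k.+2 + (i - k.+1) = i.+1)%N by clear -ki; lia.
by apply: hX; rewrite sz ltnS.
Qed.

Lemma merges_spec (x y : seq pattern * seq nat) (u : seq nat) : merges x y ->
  chainable_arch x.1 -> subseq x.2 u -> size x.2 = (size x.1).-1 ->
  [/\ chainable_arch y.1, (size y.1 <= size x.1)%N,
    subseq y.2 u /\ size y.2 = (size y.1).-1,
    arch_rows y.1 = arch_rows x.1 /\ arch_cols y.1 = arch_cols x.1 &
    forall Xs : seq (mx R), in_Sigma x.1 Xs -> exists Ys, in_Sigma y.1 Ys /\
      prodl (zip x.1 Xs) = prodl (zip y.1 Ys)].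
Proof.
elim=> {x y} [x|x y z xy _ IH] ch su sz; first by split=> // Xs; exists Xs.
have [chy szy ry cy hy] := merge_step_spec ch xy.
have [||chz szz [suz sz2] [rz cz] hz] := IH chy.
- case: xy => k [_ _ ->] /=; apply: subseq_trans su.
  rewrite -[X in subseq _ X](cat_take_drop k x.2) cat_subseq //.
  by rewrite -[k.+1]add1n -drop_drop drop_subseq.
- case: xy => k [kx _ yE]; have -> : (size y.1).-1 = (size x.1).-2 by rewrite szy.
  have ks : (k < size x.2)%N by rewrite sz; clear -kx; lia.
  rewrite yE /= size_cat size_drop size_takel ?(ltnW ks) // sz.
  by rewrite sz in ks; clear -ks; lia.
split=> //; [by rewrite szy ltnW|by rewrite rz cz|].
move=> Xs /hy [Ys [/hz [Zs [hZ e2]] e1]]; exists Zs; split=> //.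
by rewrite e1.
Qed.

(** Remaining boundaries are renumbered by their rank in the increasing list [bs], which preserves
    their order of appearance in [sigma]. *)
Lemma induced_permP sigma bs n : perm_eq sigma (iota 1 n) -> subseq bs (iota 1 n) ->
  perm_eq (induced_perm sigma bs) (iota 1 (size bs)) /\
  (sigma = iota 1 n -> induced_perm sigma bs = iota 1 (size bs)).
Proof.
move=> sP sub; have ub : uniq bs by apply: subseq_uniq sub (iota_uniq _ _).
have fE : filter (mem bs) (iota 1 n) = bs.
  by have /(subseq_uniqP (iota_uniq 1 n)) := sub.
have mE : [seq (index x bs).+1 | x <- bs] = iota 1 (size bs).
  apply: (@eq_from_nth _ 0%N); first by rewrite size_map size_iota.
  move=> i; rewrite size_map => ib; rewrite (nth_map 0%N) // index_uniq // nth_iota //.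
split=> [|->]; last by rewrite /induced_perm fE.
by rewrite -mE; apply: perm_map; rewrite -[X in perm_eq _ X]fE perm_filter.
Qed.

End Merging.

(** * Error bounds for every chainable architecture *)

Lemma frob_n2 (R : realType) m n (X : mx R) : frob m n X = Num.sqrt (n2 m n X).
Proof. by []. Qed.

Lemma butterfly_error (R : realType) beta (A : mx R) sigma Xs Ws :
  chainable_arch beta -> perm_eq sigma (iota 1 (size beta).-1) ->
  butterfly A beta sigma Xs -> in_Sigma beta Ws ->
  let E Vs := n2 (arch_rows beta) (arch_cols beta) (subm A (prodl (zip beta Vs))) in
  E Xs <= (maxn (size beta) 2).-1%:R ^+ 2 * E Ws /\
  (sigma = iota 1 (size beta).-1 -> E Xs <= (maxn (size beta) 2).-1%:R * E Ws).
Proof.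
move=> ch sP [bf1 bf2] hW /=.
have colsE b : chainable_arch b -> arch_cols b = lvl b (size b).
  by case=> -[]; rewrite /arch_cols; case: b.
have [red|nred] := pselect (redundant_arch beta); last first.
  by rewrite colsE //; apply: butterfly_nr_error (bf1 nred) hW.
have [beta' [bs [Ys [mg nred bf hX XE]]]] := bf2 red.
have [/= ch' sz' [sub szb] [re ce] hS] :=
  merges_spec R mg ch (subseq_refl _) (size_iota 1 (size beta).-1).
have [Vs [hV ->]] := hS _ hW.
have [ip ipI] := induced_permP sP sub; rewrite szb in ip ipI.
have -> : n2 (arch_rows beta) (arch_cols beta) (subm A (prodl (zip beta Xs))) =
    n2 (arch_rows beta) (arch_cols beta) (subm A (prodl (zip beta' Ys))).
  by apply: eq_n2 => i j im jn; rewrite /subm XE.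
have [h1 h2] := butterfly_nr_error ch' ip bf hV.
rewrite -re -ce colsE // ; set c' := (maxn (size beta') 2).-1 in h1 h2.
(* Merging never lengthens the architecture, so its constant is at most the original one. *)
have cc : (c' <= (maxn (size beta) 2).-1)%N by rewrite /c'; clear -sz'; lia.
have ccR : c'%:R <= (maxn (size beta) 2).-1%:R :> R by rewrite ler_nat.
split=> [|sI].
  by apply: le_trans h1 _; rewrite ler_wpM2r ?n2_ge0 // lerXn2r ?nnegrE ?ler0n.
by apply: le_trans (h2 (ipI sI)) _; rewrite ler_wpM2r ?n2_ge0.
Qed.

Theorem theorem7p4 (R : realType) (beta : seq pattern)
    (A : 'M[R[i]]_(arch_rows beta, arch_cols beta))
    (sigma : seq nat) (Xs : seq (mx R)) :
  chainable_arch beta ->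
  (1 <= size beta)%N ->
  perm_eq sigma (iota 1 (size beta).-1) ->
  butterfly (mx_of A) beta sigma Xs ->
  frob (arch_rows beta) (arch_cols beta)
       (fun i j => mx_of A i j - prodl (zip beta Xs) i j)
    <= ((maxn (size beta) 2).-1)%:R * Ebeta beta (mx_of A)
  /\ (sigma = iota 1 (size beta).-1 ->
      frob (arch_rows beta) (arch_cols beta)
           (fun i j => mx_of A i j - prodl (zip beta Xs) i j)
        <= Num.sqrt ((maxn (size beta) 2).-1)%:R * Ebeta beta (mx_of A)).
Proof.
move=> ch _ sP bf; set c : R := (maxn (size beta) 2).-1%:R.
have c0 : 0 < c by rewrite ltr0n; case: (size beta) => [|[|n]].
have inf_bound (x d : R) : 0 < d -> (forall Ws, in_Sigma beta Ws -> x <= d *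
    frob (arch_rows beta) (arch_cols beta) (subm (mx_of A) (prodl (zip beta Ws)))) ->
    x <= d * Ebeta beta (mx_of A).
  move=> d0 h; rewrite -ler_pdivrMl //; apply: lb_le_inf; last first.
    by move=> _ [Ws [hW ->]]; rewrite ler_pdivrMl //; apply: h.
  (* Zero factors witness that the set of errors is nonempty, as [lb_le_inf] demands. *)
  pose Z := nseq (size beta) (mx0 R).
  exists (frob (arch_rows beta) (arch_cols beta) (subm (mx_of A) (prodl (zip beta Z)))).
  exists Z; split=> //; split; first by rewrite size_nseq.
  by move=> k kb i j _; rewrite nth_nseq kb.
split=> [|sI]; apply: inf_bound => [|Ws hW].
- exact: c0.
- have [h _] := butterfly_error ch sP bf hW; rewrite !frob_n2.
  rewrite -[c]ger0_norm ?(ltW c0) // -sqrtr_sqr -sqrtrM ?sqr_ge0 //.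
  by rewrite ler_sqrt // mulr_ge0 ?sqr_ge0 ?n2_ge0.
- by rewrite sqrtr_gt0.
have [_ /(_ sI) h] := butterfly_error ch sP bf hW; rewrite !frob_n2.
by rewrite -sqrtrM ?(ltW c0) // ler_sqrt // mulr_ge0 ?(ltW c0) ?n2_ge0.
Qed.
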